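(* Let $\pi$ be a pyramid corresponding to a partition of $N$ and let $A\in\mathrm{Tab}_{\Bbbk}(\pi)$ be column connected. Then the 1-dimensional $U(\mathfrak{g},e)$-module $\widetilde{\Bbbk}_{\bar A}$ factors to a module for $U_0(\mathfrak{g},e)$ (i.e. the action factors through the quotient map $U(\mathfrak{g},e)\twoheadrightarrow U_0(\mathfrak{g},e)$) if and only if $A\in\mathrm{Tab}_{\mathbb{F}_p}(\pi)$.
   Context: **Setting.** $\Bbbk$ is an algebraically closed field of characteristic $p>0$ with prime subfield $\mathbb{F}_p$, $N\ge1$, $G=\mathrm{GL}_N(\Bbbk)$, $\mathfrak{g}=\mathfrak{gl}_N(\Bbbk)$ with matrix units $e_{i,j}$ and trace form $(x,y)=\mathrm{tr}(xy)$; $x^{[p]}$ is the $p$th power of $x\in\mathfrak g$ as a matrix; $G$ acts on $U(\mathfrak{g})$ by extending the adjoint action. **Pyramid.** $(p_1\le\dots\le p_n)$ is a partition of $N$ with (positive) parts $p_i$. A pyramid $\pi$ associated to it is a diagram of $N$ boxes with rows $1,\dots,n$ from top to bottom, row $i$ consisting of $p_i$ consecutive boxes, such that every box not in the bottom row lies directly above a box in the row beneath it. Columns are labelled $1,\dots,l$ from left to right, $l=p_n$, with heights $q_1,\dots,q_l$. Boxes are numbered $1,\dots,N$ along rows from left to right, starting with the top row; $\mathrm{row}(i),\mathrm{col}(i)$ are the row and column of box $i$. Put $e=\sum e_{i,j}$, the sum over $i,j$ with $\mathrm{row}(i)=\mathrm{row}(j)$, $\mathrm{col}(i)=\mathrm{col}(j)-1$,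 and $\chi=(e,\cdot)\in\mathfrak{g}^*$. **The $W$-algebras.** Let $\mathfrak{p}=\mathrm{span}\{e_{i,j}\mid\mathrm{col}(i)\le\mathrm{col}(j)\}$, with Levi factor $\mathfrak{h}=\mathrm{span}\{e_{i,j}\mid\mathrm{col}(i)=\mathrm{col}(j)\}$, let $\mathfrak{m}=\mathrm{span}\{e_{i,j}\mid\mathrm{col}(i)>\mathrm{col}(j)\}$, and let $M\le G$ be the closed subgroup generated by the root subgroups $\{1+se_{i,j}\mid s\in\Bbbk\}$ with $\mathrm{col}(j)<\mathrm{col}(i)$. Put $\mathfrak{m}_\chi=\{x-\chi(x)\mid x\in\mathfrak{m}\}\subseteq U(\mathfrak{g})$. Then $U(\mathfrak{g})=U(\mathfrak{g})\mathfrak{m}_\chi\oplus U(\mathfrak{p})$; let $\mathrm{pr}:U(\mathfrak{g})\to U(\mathfrak{p})$ be the projection. The twisted adjoint action of $M$ on $U(\mathfrak{p})$ is $\mathrm{tw}(g)\cdot u=\mathrm{pr}(g\cdot u)$, and $U(\mathfrak{g},e)=\{u\in U(\mathfrak{p})\mid \mathrm{tw}(g)\cdot u=u\ \text{for all } g\in M\}$. Let $J_0^{\mathfrak{p}}$ be the ideal of $U(\mathfrak{p})$ generated by $\{x^p-x^{[p]}\mid x\in\mathfrak{p}\}$; the restricted $W$-algebra is $U_0(\mathfrak{g},e)=U(\mathfrak{g},e)/(J_0^{\mathfrak{p}}\cap U(\mathfrak{g},e))$. **Tableaux and modules.** $\mathrm{Tab}_{\Bbbk}(\pi)$ (resp.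 $\mathrm{Tab}_{\mathbb{F}_p}(\pi)$) is the set of fillings of the boxes of $\pi$ with elements of $\Bbbk$ (resp. $\mathbb{F}_p$); $a_i$ is the entry of $A$ in box $i$. $A$ is *column connected* if $a_i=a_j+1$ whenever box $i$ is directly above box $j$. Let $\mathfrak{t}$ be the diagonal matrices, $\epsilon_1,\dots,\epsilon_N$ the standard basis of $\mathfrak{t}^*$, $\lambda_A=\sum_i a_i\epsilon_i$, and $$\widetilde\rho=\sum_{i=1}^N\big(n-q_{\mathrm{col}(i)}-q_{\mathrm{col}(i)+1}-\dots-q_l-\mathrm{row}(i)\big)\epsilon_i .$$ For column connected $A\in\mathrm{Tab}_{\Bbbk}(\pi)$, $\lambda_A-\widetilde\rho$ is the weight of a 1-dimensional $U(\mathfrak{h})$-module; $\widetilde{\Bbbk}_A$ denotes this module inflated to $U(\mathfrak{p})$ (the nilradical of $\mathfrak{p}$ acts by zero), and $\widetilde{\Bbbk}_{\bar A}$ denotes the restriction of $\widetilde{\Bbbk}_A$ to $U(\mathfrak{g},e)\subseteq U(\mathfrak{p})$. *)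

(* Defs.v *)
From HB Require Import structures.
From mathcomp Require Import all_boot all_order all_algebra.
From mathcomp Require Import generic_quotient boolp.
From mathcomp.multinomials Require monalg mpoly.
From mathcomp Require finmap.
From mathcomp Require Import ring.

Set Implicit Arguments.
Unset Strict Implicit.
Unset Printing Implicit Defensive.

Import GRing.Theory.
Local Open Scope ring_scope.
Local Open Scope quotient_scope.

Section TwoSidedIdeals.
Variables (K : fieldType) (A : algType K).

Definition ideal2 (I : A -> Prop) : Prop :=
  [/\ I 0, forall x y, I x -> I y -> I (x - y),
      forall a x, I x -> I (a * x) & forall a x, I x -> I (x * a)].

Definition ideal_gen (S : A -> Prop) (x : A) : Prop :=
  forall I : A -> Prop, ideal2 I -> (forall y, S y -> I y) -> I x.

Lemma ideal_gen_ideal2 (S : A -> Prop) : ideal2 (ideal_gen S).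
Proof.
split=> [I [I0 _ _ _] //|x y Sx Sy I HI SI|a x Sx I HI SI|a x Sx I HI SI];
  case: (HI) => I0 IB IMl IMr.
- by apply: IB; [apply: Sx|apply: Sy].
- by apply: IMl; apply: Sx.
- by apply: IMr; apply: Sx.
Qed.

Lemma ideal_gen_sub (S : A -> Prop) x : S x -> ideal_gen S x.
Proof. by move=> Sx I _; apply. Qed.

(* properness is required because algType only covers nonzero algebras *)
Record proper_ideal2 := ProperIdeal2 {
  ideal_set :> A -> Prop;
  ideal_setP : ideal2 ideal_set;
  ideal_proper : ~ ideal_set 1 }.

Variable I : proper_ideal2.

Definition ideal_mem : {pred A} := fun x => `[< I x >].

Lemma ideal_mem_zmod : zmod_closed ideal_mem.
Proof.
case: (ideal_setP I) => I0 IB _ _.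
split=> [|x y]; rewrite !unfold_in; first exact/asboolP.
by move=> /asboolP Ix /asboolP Iy; apply/asboolP/IB.
Qed.

HB.instance Definition _ := GRing.isZmodClosed.Build A ideal_mem ideal_mem_zmod.

Definition quot_alg : Type := {ideal_quot (ideal_mem : zmodClosed A)}.
HB.instance Definition _ := GRing.Zmodule.on quot_alg.

Definition quot_pi (x : A) : quot_alg :=
  \pi_({ideal_quot (ideal_mem : zmodClosed A)}) x.
Definition quot_repr (x : quot_alg) : A :=
  repr (x : {ideal_quot (ideal_mem : zmodClosed A)}).

Lemma quot_reprK x : quot_pi (quot_repr x) = x.
Proof. exact: reprK. Qed.

Lemma quot_piP x y : quot_pi x = quot_pi y <-> I (x - y).
Proof.
have := Quotient.idealrBE (ideal_mem : zmodClosed A) x y.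
rewrite unfold_in => e; split => [/eqP|H].
  by move=> h; apply/asboolP; rewrite e.
by apply/eqP; rewrite -[_ == _]e; apply/asboolP.
Qed.

Fact quot_pi_zmod : zmod_morphism quot_pi.
Proof. by move=> x y; rewrite /quot_pi raddfB. Qed.

HB.instance Definition _ :=
  GRing.isZmodMorphism.Build A quot_alg quot_pi quot_pi_zmod.

Let ind (P : quot_alg -> Prop) : (forall x, P (quot_pi x)) -> forall q, P q.
Proof. by move=> H q; rewrite -(quot_reprK q). Qed.

Definition quot_mul (x y : quot_alg) : quot_alg :=
  quot_pi (quot_repr x * quot_repr y).
Definition quot_scale (c : K) (x : quot_alg) : quot_alg :=
  quot_pi (c *: quot_repr x).

Let reprB x : I (quot_repr (quot_pi x) - x).
Proof. by apply/quot_piP; rewrite quot_reprK. Qed.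

Fact quot_piM x y : quot_mul (quot_pi x) (quot_pi y) = quot_pi (x * y).
Proof.
apply/quot_piP; case: (ideal_setP I) => I0 IB IMl IMr.
set x' := quot_repr _; set y' := quot_repr _.
have -> : x' * y' - x * y = (x' - x) * y' - x * (y - y').
  by rewrite mulrBl mulrBr opprB addrA subrK.
apply: (IB); first exact/IMr/reprB.
by apply: IMl; rewrite -opprB -[- _]add0r; apply: IB => //; apply: reprB.
Qed.

Fact quot_piZ c x : quot_scale c (quot_pi x) = quot_pi (c *: x).
Proof.
apply/quot_piP; case: (ideal_setP I) => I0 IB IMl IMr.
by rewrite -scalerBr -mulr_algl; apply/IMl/reprB.
Qed.

Fact quot_mulA : associative quot_mul.
Proof.
by elim/ind=> x; elim/ind=> y; elim/ind=> z; rewrite !quot_piM mulrA.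
Qed.
Fact quot_mul1 : left_id (quot_pi 1) quot_mul.
Proof. by elim/ind=> x; rewrite quot_piM mul1r. Qed.
Fact quot_mulr1 : right_id (quot_pi 1) quot_mul.
Proof. by elim/ind=> x; rewrite quot_piM mulr1. Qed.
Fact quot_mulDl : left_distributive quot_mul +%R.
Proof.
elim/ind=> x; elim/ind=> y; elim/ind=> z.
by rewrite -raddfD !quot_piM -raddfD mulrDl.
Qed.
Fact quot_mulDr : right_distributive quot_mul +%R.
Proof.
elim/ind=> x; elim/ind=> y; elim/ind=> z.
by rewrite -raddfD !quot_piM -raddfD mulrDr.
Qed.
Fact quot_1neq0 : quot_pi 1 != 0.
Proof.
apply/negP => /eqP; rewrite -(raddf0 quot_pi) => /quot_piP; rewrite subr0.
exact: ideal_proper.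
Qed.

HB.instance Definition _ := GRing.Zmodule_isNzRing.Build quot_alg
  quot_mulA quot_mul1 quot_mulr1 quot_mulDl quot_mulDr quot_1neq0.

Fact quot_scaleA a b v : quot_scale a (quot_scale b v) = quot_scale (a * b) v.
Proof. by elim/ind: v => x; rewrite !quot_piZ scalerA. Qed.
Fact quot_scale1 : left_id 1 quot_scale.
Proof. by elim/ind=> x; rewrite quot_piZ scale1r. Qed.
Fact quot_scaleDr : right_distributive quot_scale +%R.
Proof.
by move=> a; elim/ind=> x; elim/ind=> y; rewrite -raddfD !quot_piZ -raddfD scalerDr.
Qed.
Fact quot_scaleDl v : {morph quot_scale^~ v : a b / a + b}.
Proof. by elim/ind: v => x a b; rewrite !quot_piZ -raddfD scalerDl. Qed.

HB.instance Definition _ := GRing.Zmodule_isLmodule.Build K quot_alg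
  quot_scaleA quot_scale1 quot_scaleDr quot_scaleDl.

Fact quot_scaleAl (a : K) (x y : quot_alg) : a *: (x * y) = (a *: x) * y.
Proof.
elim/ind: x => x; elim/ind: y => y.
by rewrite /GRing.mul /GRing.scale /= quot_piZ !quot_piM quot_piZ scalerAl.
Qed.
HB.instance Definition _ := GRing.Lmodule_isLalgebra.Build K quot_alg quot_scaleAl.

Fact quot_scaleAr (a : K) (x y : quot_alg) : a *: (x * y) = x * (a *: y).
Proof.
elim/ind: x => x; elim/ind: y => y.
by rewrite /GRing.mul /GRing.scale /= quot_piZ !quot_piM quot_piZ scalerAr.
Qed.
HB.instance Definition _ := GRing.Lalgebra_isAlgebra.Build K quot_alg quot_scaleAr.

Fact quot_pi_monoid : monoid_morphism quot_pi.
Proof. by split=> // x y; rewrite -quot_piM. Qed.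
HB.instance Definition _ :=
  GRing.isMonoidMorphism.Build A quot_alg quot_pi quot_pi_monoid.

Fact quot_pi_scalable : scalable quot_pi.
Proof. by move=> c x; rewrite -quot_piZ. Qed.
HB.instance Definition _ :=
  GRing.isScalable.Build K A quot_alg *:%R quot_pi quot_pi_scalable.

End TwoSidedIdeals.

Section FreeAlgebra.
Import monalg.

Fact free_scalerAr (R : comNzRingType) (X : choiceType) (a : R)
    (x y : {malg R[{fmonom X}]}) :
  a *: (x * y) = x * (a *: y).
Proof.
apply/malgP => k; rewrite mcoeffZ.
apply: etrans (congr1 (fun t => a * t) (mcoeffMl x y k)) _.
apply: etrans _ (esym (mcoeffMlw k (finmap.fsubset_refl _) (msuppZ_le a y))).
rewrite mulr_sumr; apply: eq_bigr => i _.
rewrite mulr_sumr; apply: eq_bigr => j _.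
by rewrite mcoeffZ mulrnAr mulrCA.
Qed.
Fact malgU_scale (R : comNzRingType) (X : choiceType) (a : R) (m : {fmonom X}) :
  << a *g m >> = a *: << m >> :> {malg R[{fmonom X}]}.
Proof. apply/malgP => k.
apply: etrans (mcoeffU m a k) _; rewrite mcoeffZ.
apply: etrans _ (esym (congr1 (fun t => a * t) (mcoeffU m 1 k))).
by rewrite mulrnAr mulr1. Qed.

Variables (K : fieldType) (X : choiceType).

Definition free_alg : Type := {malg K[{fmonom X}]}.
HB.instance Definition _ := GRing.Lalgebra.on free_alg.
HB.instance Definition _ := GRing.Lalgebra_isAlgebra.Build K free_alg
  (@free_scalerAr K X).

Definition free_gen (x : X) : free_alg := << fmu x >>.

Variables (A : algType K) (f : X -> A).

Definition word_eval (m : {fmonom X}) : A := \prod_(x <- (m : seq X)) f x.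

Fact word_eval_mmorphism : mmorphism word_eval.
Proof.
by split=> [m1 m2|]; rewrite /word_eval ?fmM ?big_cat //= fm1 big_nil.
Qed.
HB.instance Definition _ :=
  isMultiplicative.Build {fmonom X} A word_eval word_eval_mmorphism.

Definition free_lift (u : free_alg) : A := mmap (in_alg A) word_eval u.

Fact free_lift_linear : linear free_lift.
Proof.
by move=> c x y; rewrite /free_lift raddfD /= (mmapZ (f:=in_alg A)) mulr_algl.
Qed.
HB.instance Definition _ :=
  GRing.isLinear.Build K free_alg A *:%R free_lift free_lift_linear.

Fact free_lift_monoid : monoid_morphism free_lift.
Proof.
have H (g : {malg K[{fmonom X}]}) m m' :
    GRing.comm (in_alg A g@_m) (word_eval m').
  by rewrite /GRing.comm /= mulr_algl mulr_algr.
by case: (commr_mmap_is_multiplicative H).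
Qed.
HB.instance Definition _ :=
  GRing.isMonoidMorphism.Build free_alg A free_lift free_lift_monoid.

Lemma free_liftE x : free_lift (free_gen x) = f x.
Proof.
rewrite /free_lift /free_gen mmapU /= scale1r mul1r /word_eval fmU.
by rewrite big_seq1.
Qed.

Lemma free_ind (P : free_alg -> Prop) :
    P 1 -> (forall a x y, P x -> P y -> P (a *: x + y)) ->
    (forall x y, P x -> P y -> P (x * y)) -> (forall x, P (free_gen x)) ->
  forall u, P u.
Proof.
move=> P1 PD PM PX u.
have P0 : P 0 by rewrite -[0](addNr 1) -scaleN1r; apply: PD.
have PZ a x : P x -> P (a *: x) by move=> Px; rewrite -[_ *: _]addr0; apply: PD.
have PA x y : P x -> P y -> P (x + y).
  by move=> Px Py; rewrite -[x]scale1r; apply: PD.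
rewrite [u]monalgE; elim/big_ind: _ => // m _.
rewrite malgU_scale.
apply: PZ; case: m => s; elim: s => [|x s IH].
  by rewrite -fmoneE.
have -> : << FMonom (x :: s) >> = free_gen x * << FMonom s >>.
  by rewrite malgM_def fgmulUU mulr1 /mmul /= fmmulE fmU.
by apply: PM.
Qed.

End FreeAlgebra.

HB.mixin Record Lmodule_isLie (K : fieldType) V of GRing.Lmodule K V := {
  lie : V -> V -> V;
  lieDl : forall (a : K) (x y z : V), lie (a *: x + y) z = a *: lie x z + lie y z;
  lieDr : forall (a : K) (x y z : V), lie z (a *: x + y) = a *: lie z x + lie z y;
  liexx : forall x, lie x x = 0;
  lie_jacobi : forall x y z,
    lie x (lie y z) + lie y (lie z x) + lie z (lie x y) = 0 }.

#[short(type="lieAlgType")]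
HB.structure Definition LieAlgebra (K : fieldType) :=
  {V of GRing.Lmodule K V & Lmodule_isLie K V}.

Definition lie_hom_to_alg (K : fieldType) (L : lieAlgType K) (A : algType K)
    (f : L -> A) : Prop :=
  linear f /\ forall x y, f (lie x y) = f x * f y - f y * f x.

Definition lie_hom (K : fieldType) (L L' : lieAlgType K) (f : L -> L') : Prop :=
  linear f /\ forall x y, f (lie x y) = lie (f x) (f y).

(* The relations presenting U(L) on the generators g x, x in L *)
Variant uea_rel (K : fieldType) (L : lieAlgType K) (T : algType K) (g : L -> T) :
  T -> Prop :=
| UeaLin (a : K) (x y : L) : uea_rel g (g (a *: x + y) - (a *: g x + g y))
| UeaLie (x y : L) : uea_rel g (g x * g y - g y * g x - g (lie x y)).

Lemma uea_rel_kill (K : fieldType) (L : lieAlgType K) (T A : algType K)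
    (g : L -> T) (f : L -> A) (F : {lrmorphism T -> A}) :
    (forall x, F (g x) = f x) -> lie_hom_to_alg f ->
  forall u, ideal_gen (uea_rel g) u -> F u = 0.
Proof.
move=> FE [flin fl] u Hu; apply: (Hu (fun v => F v = 0)).
  split=> [|x y|a x|a x]; rewrite ?raddf0 ?raddfB ?rmorphM //=.
  - by move=> -> ->; rewrite subr0.
  - by move=> ->; rewrite mulr0.
  - by move=> ->; rewrite mul0r.
move=> _ [a x y|x y]; first by rewrite raddfB /= raddfD /= linearZ /= !FE flin subrr.
by rewrite raddfB /= raddfB /= !rmorphM /= !FE fl subrr.
Qed.

Record enveloping_algebra (K : fieldType) (L : lieAlgType K) := EnvelopingAlgebra {
  env_alg :> algType K;
  env_in : L -> env_alg;
  env_lift : forall A : algType K, (L -> A) -> env_alg -> A;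
  env_in_hom : lie_hom_to_alg env_in;
  env_ind : forall P : env_alg -> Prop,
    P 1 -> (forall a x y, P x -> P y -> P (a *: x + y)) ->
    (forall x y, P x -> P y -> P (x * y)) -> (forall x, P (env_in x)) ->
    forall u, P u;
  env_liftP : forall (A : algType K) (f : L -> A), lie_hom_to_alg f ->
    [/\ linear (@env_lift A f), monoid_morphism (@env_lift A f) &
        forall x, env_lift f (env_in x) = f x] }.

Section EnvelopingAlgebra.
Variables (K : fieldType) (L : lieAlgType K).
Local Notation T := (free_alg K L).
Local Notation g := (@free_gen K L).

Fact uea_proper : ~ ideal_gen (uea_rel (g : L -> T)) 1.
Proof.
have H : lie_hom_to_alg (fun _ : L => (0 : K^o)).
  by split=> [a x y|x y]; rewrite ?scaler0 ?addr0 // mulr0 subr0.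
move=> H1; have := uea_rel_kill (free_liftE (fun _ : L => (0 : K^o))) H H1.
by move=> /eqP; rewrite rmorph1 oner_eq0.
Qed.

Definition uea_ideal : proper_ideal2 T :=
  ProperIdeal2 (ideal_gen_ideal2 (uea_rel (g : L -> T))) uea_proper.

Local Notation U := (quot_alg uea_ideal).
Local Notation pi := (quot_pi uea_ideal).

Definition uea_quot_in (x : L) : U := pi (g x).
Definition uea_quot_lift (A : algType K) (f : L -> A) (u : U) : A :=
  free_lift f (quot_repr u).

Fact uea_quot_in_hom : lie_hom_to_alg uea_quot_in.
Proof.
split=> [a x y|x y].
  rewrite /uea_quot_in -linearP; apply/quot_piP; apply: ideal_gen_sub.
  exact: UeaLin.
rewrite /uea_quot_in -!rmorphM -raddfB; apply/esym/quot_piP.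
apply: ideal_gen_sub; exact: UeaLie.
Qed.

Let ind (P : U -> Prop) : (forall x, P (pi x)) -> forall q, P q.
Proof. by move=> H q; rewrite -(quot_reprK q). Qed.

Fact uea_quot_ind (P : U -> Prop) :
    P 1 -> (forall a x y, P x -> P y -> P (a *: x + y)) ->
    (forall x y, P x -> P y -> P (x * y)) -> (forall x, P (uea_quot_in x)) ->
  forall u, P u.
Proof.
move=> P1 PD PM PX; elim/ind; elim/free_ind => [|a x y Px Py|x y Px Py|x].
- by rewrite rmorph1.
- by rewrite linearP; apply: PD.
- by rewrite rmorphM; apply: PM.
- exact: PX.
Qed.

Fact uea_quot_liftP (A : algType K) (f : L -> A) : lie_hom_to_alg f ->
  [/\ linear (@uea_quot_lift A f), monoid_morphism (@uea_quot_lift A f) &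
      forall x, uea_quot_lift f (uea_quot_in x) = f x].
Proof.
move=> fH.
have E u : uea_quot_lift f (pi u) = free_lift f u.
  apply/eqP; rewrite -subr_eq0 -raddfB; apply/eqP.
  apply: (uea_rel_kill (free_liftE f) fH).
  by apply/(quot_piP uea_ideal); rewrite quot_reprK.
split=> [a|| x]; last by rewrite /uea_quot_in E free_liftE.
  by elim/ind=> x; elim/ind=> y; rewrite -linearP !E linearP.
split; first by rewrite -(rmorph1 pi) E rmorph1.
by elim/ind=> x; elim/ind=> y; rewrite -rmorphM !E rmorphM.
Qed.

Definition uea_quot : enveloping_algebra L :=
  @EnvelopingAlgebra K L (U : algType K) uea_quot_in uea_quot_lift
    uea_quot_in_hom uea_quot_ind uea_quot_liftP.
End EnvelopingAlgebra.

(* Locked for efficiency: the fields of enveloping_algebra determine it up to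
   unique isomorphism. *)
HB.lock Definition uea_locked (K : fieldType) (L : lieAlgType K) :
  enveloping_algebra L := uea_quot L.

Section EnvelopingTheory.
Variables (K : fieldType) (L : lieAlgType K).

Definition uea : algType K := uea_locked L.
Definition uea_in (x : L) : uea := env_in (uea_locked L) x.

Lemma uea_in_hom : lie_hom_to_alg uea_in.
Proof. exact: env_in_hom. Qed.

HB.instance Definition _ :=
  GRing.isLinear.Build K L uea *:%R uea_in (proj1 uea_in_hom).

Lemma uea_in_lie x y : uea_in (lie x y) = uea_in x * uea_in y - uea_in y * uea_in x.
Proof. exact: (proj2 uea_in_hom). Qed.

Lemma uea_ind (P : uea -> Prop) :
    P 1 -> (forall a x y, P x -> P y -> P (a *: x + y)) ->
    (forall x y, P x -> P y -> P (x * y)) -> (forall x, P (uea_in x)) ->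
  forall u, P u.
Proof. exact: env_ind. Qed.

Variable A : algType K.

(* The algebra morphism extending f; meaningful when lie_hom_to_alg f holds *)
Definition uea_lift (f : L -> A) : uea -> A := env_lift f.

Variables (f : L -> A) (fH : lie_hom_to_alg f).

Lemma uea_liftE x : uea_lift f (uea_in x) = f x.
Proof. by have [_ _] := env_liftP (uea_locked L) fH; apply. Qed.

Lemma uea_lift_linear : linear (uea_lift f).
Proof. by have [] := env_liftP (uea_locked L) fH. Qed.

Lemma uea_lift_monoid : monoid_morphism (uea_lift f).
Proof. by have [] := env_liftP (uea_locked L) fH. Qed.

Lemma uea_lift_uniq (F : {lrmorphism uea -> A}) :
  (forall x, F (uea_in x) = f x) -> F =1 uea_lift f.
Proof.
have [F1 FM] := uea_lift_monoid.
move=> FE; elim/uea_ind => [|a x y IHx IHy|x y IHx IHy|x].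
- by rewrite rmorph1 F1.
- by rewrite linearP /= uea_lift_linear IHx IHy.
- by rewrite rmorphM /= FM IHx IHy.
- by rewrite FE uea_liftE.
Qed.
End EnvelopingTheory.

Definition uea_map (K : fieldType) (L L' : lieAlgType K) (f : L -> L') :
  uea L -> uea L' := uea_lift (fun x => uea_in (f x)).

Lemma uea_map_hom (K : fieldType) (L L' : lieAlgType K) (f : L -> L') :
  lie_hom f -> lie_hom_to_alg (fun x => uea_in (f x)).
Proof.
by case=> flin fl; split=> [a x y|x y]; rewrite ?flin ?linearP // fl uea_in_lie.
Qed.

Section MatrixLie.
Variables (K : fieldType) (N : nat).
Implicit Types x y z : 'M[K]_N.

Definition mxlie x y := x *m y - y *m x.

Fact mxlieDl (a : K) x y z : mxlie (a *: x + y) z = a *: mxlie x z + mxlie y z.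
Proof.
rewrite /mxlie mulmxDl mulmxDr -scalemxAl -scalemxAr scalerBr.
by rewrite opprD addrACA.
Qed.

Fact mxlieDr (a : K) x y z : mxlie z (a *: x + y) = a *: mxlie z x + mxlie z y.
Proof.
rewrite /mxlie mulmxDl mulmxDr -scalemxAl -scalemxAr scalerBr.
by rewrite opprD addrACA.
Qed.

Fact mxliexx x : mxlie x x = 0. Proof. exact: subrr. Qed.

Fact mxlie_jacobi x y z :
  mxlie x (mxlie y z) + mxlie y (mxlie z x) + mxlie z (mxlie x y) = 0.
Proof.
rewrite /mxlie !mulmxBl !mulmxBr !mulmxA.
set a := x *m y *m z; set b := x *m z *m y; set c := y *m z *m x.
set d := z *m y *m x; set e := y *m x *m z; set f := z *m x *m y.
apply/matrixP=> i j; rewrite !mxE; ring.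
Qed.

HB.instance Definition _ := Lmodule_isLie.Build K 'M[K]_N
  mxlieDl mxlieDr mxliexx mxlie_jacobi.

Definition unit_span (r : rel 'I_N) : {vspace 'M[K]_N} :=
  <<[seq delta_mx i j | i <- enum 'I_N, j <- enum (r i)]>>%VS.

Lemma mem_unit_span (r : rel 'I_N) x :
  reflect (forall i j, ~~ r i j -> x i j = 0) (x \in unit_span r).
Proof.
apply: (iffP idP) => [xr i j nr|H].
  have /coord_span -> : x \in <<in_tuple
    [seq delta_mx i j : 'M[K]_N | i <- enum 'I_N, j <- enum (r i)]>>%VS by [].
  rewrite summxE big1 // => k _; rewrite mxE; set d := (X in X`_k).
  have /allpairsPdep[a [b [_ + ->]]] : d`_k \in d by apply: mem_nth.
  rewrite mem_enum mxE => rab.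
  case: eqP => [ia|]; case: eqP => [jb|]; rewrite ?mulr0 //.
  by move: nr; rewrite ia jb; move: rab; rewrite /in_mem /= => ->.
rewrite [x]matrix_sum_delta; apply: memv_suml => i _; apply: memv_suml => j _.
have [rij|/H->] := boolP (r i j); last by rewrite scale0r mem0v.
apply: memvZ; apply: memv_span; apply/allpairsPdep.
by exists i, j; rewrite !mem_enum.
Qed.

Lemma unit_span_mul (r : rel 'I_N) x y : transitive r ->
  x \in unit_span r -> y \in unit_span r -> x *m y \in unit_span r.
Proof.
move=> rtr /mem_unit_span Hx /mem_unit_span Hy; apply/mem_unit_span => i j nr.
rewrite mxE big1 // => k _.
have [rik|/Hx->] := boolP (r i k); last by rewrite mul0r.
have [rkj|/Hy->] := boolP (r k j); last by rewrite mulr0.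
by rewrite (rtr _ _ _ rik rkj) in nr.
Qed.

Definition sub_lie (U : {vspace 'M[K]_N}) (x y : subvs_of U) : subvs_of U :=
  vsproj U (lie (vsval x) (vsval y)).

Section SubLie.
Variables (r : rel 'I_N) (rtr : transitive r).
Local Notation U := (unit_span r).
Implicit Types u v w : subvs_of U.

Lemma sub_lieE u v : vsval (sub_lie u v) = lie (vsval u) (vsval v).
Proof. by rewrite vsprojK // rpredB // unit_span_mul ?subvsP. Qed.

Fact sub_lieDl (a : K) u v w :
  sub_lie (a *: u + v) w = a *: sub_lie u w + sub_lie v w.
Proof. by rewrite /sub_lie linearP lieDl linearP. Qed.
Fact sub_lieDr (a : K) u v w :
  sub_lie w (a *: u + v) = a *: sub_lie w u + sub_lie w v.
Proof. by rewrite /sub_lie linearP lieDr linearP. Qed.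
Fact sub_liexx u : sub_lie u u = 0.
Proof. by rewrite /sub_lie liexx raddf0. Qed.
Fact sub_lie_jacobi u v w :
  sub_lie u (sub_lie v w) + sub_lie v (sub_lie w u) + sub_lie w (sub_lie u v) = 0.
Proof. by apply: val_inj; rewrite !raddfD /= !sub_lieE lie_jacobi. Qed.

End SubLie.
End MatrixLie.

Section Boxes.
Variables (parts offsets : seq nat) (N : nat).

(* Boxes are numbered along rows by 'I_N, counting from 0; rows and columns
   are numbered from 1. The r-th row (r counted from 0) occupies the columns
   offsets`_r + 1, ..., offsets`_r + parts`_r. *)
Definition box_row (i : 'I_N) : nat := (reshape_index parts i).+1.
Definition box_col (i : 'I_N) : nat :=
  (nth 0%N offsets (reshape_index parts i) + reshape_offset parts i).+1.
End Boxes.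

Record pyramid (N : nat) := Pyramid {
  parts : seq nat;
  offsets : seq nat;
  parts_sorted : sorted leq parts;
  parts_gt0 : all (ltn 0) parts;
  parts_sum : sumn parts = N;
  size_offsets : size offsets = size parts;
  bottom_offset : last 0%N offsets = 0%N;
  box_supported : forall i : 'I_N, (box_row parts i < size parts)%N ->
    exists j : 'I_N, box_row parts j = (box_row parts i).+1
                  /\ box_col parts offsets j = box_col parts offsets i }.

Section PyramidData.
Variables (N : nat) (pi : pyramid N).

Definition nrows : nat := size (parts pi).
Definition ncols : nat := last 0%N (parts pi).
Definition row_of (i : 'I_N) : nat := box_row (parts pi) i.
Definition col_of (i : 'I_N) : nat := box_col (parts pi) (offsets pi) i.
Definition height (c : nat) : nat := #|[set i : 'I_N | col_of i == c]|.

Definition directly_above (i j : 'I_N) : Prop :=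
  (row_of i).+1 = row_of j /\ col_of i = col_of j.

Lemma row_of_le i : (row_of i <= nrows)%N.
Proof. by rewrite reshape_indexP // (parts_sum pi). Qed.

Lemma box_inj i j : row_of i = row_of j -> col_of i = col_of j -> i = j.
Proof.
move=> [ri] [ci]; apply: val_inj.
rewrite -[val i](reshape_indexK (parts pi)) -[val j](reshape_indexK (parts pi)).
by rewrite -!/(nat_of_ord _) ri; congr flatten_index; move: ci; rewrite ri => /addnI.
Qed.

Lemma const_on_columns (T : Type) (f : 'I_N -> T) :
    (forall i j, directly_above i j -> f i = f j) ->
  forall i j, col_of i = col_of j -> f i = f j.
Proof.
move=> Hf.
have bot i : exists2 j, row_of j = nrows /\ col_of j = col_of i & f i = f j.
  have [m] := ubnP (nrows - row_of i)%N; elim: m i => // m IH i Hm.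
  have := row_of_le i; rewrite leq_eqVlt => /orP[/eqP ri|ri]; first by exists i.
  have [j [rj cj]] := box_supported ri.
  have [|k [rk ck] fk] := IH j.
    by rewrite -ltnS (leq_trans _ Hm) // ltnS /row_of rj ltn_sub2l.
  exists k; first by rewrite rk ck; split=> //; exact: cj.
  by rewrite -fk; apply: Hf.
move=> i j cij; have [i' [ri ci] ->] := bot i; have [j' [rj cj] ->] := bot j.
by congr f; apply: box_inj; rewrite ?ri ?rj // ci cj.
Qed.

Variable K : fieldType.

Definition par_space : {vspace 'M[K]_N} :=
  unit_span K (fun i j => col_of i <= col_of j)%N.
Definition levi_space : {vspace 'M[K]_N} :=
  unit_span K (fun i j => col_of i == col_of j).
Definition m_space : {vspace 'M[K]_N} :=
  unit_span K (fun i j => col_of j < col_of i)%N.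

Definition par : Type := subvs_of par_space.
Definition levi : Type := subvs_of levi_space.
HB.instance Definition _ := GRing.Lmodule.on par.
HB.instance Definition _ := GRing.Lmodule.on levi.

Fact par_trans : transitive (fun i j : 'I_N => col_of i <= col_of j)%N.
Proof. by move=> j i k; apply: leq_trans. Qed.
Fact levi_trans : transitive (fun i j : 'I_N => col_of i == col_of j).
Proof. by move=> j i k /eqP->. Qed.

HB.instance Definition _ := Lmodule_isLie.Build K par
  (@sub_lieDl K N _) (@sub_lieDr K N _) (@sub_liexx K N _)
  (sub_lie_jacobi par_trans).
HB.instance Definition _ := Lmodule_isLie.Build K levi
  (@sub_lieDl K N _) (@sub_lieDr K N _) (@sub_liexx K N _)
  (sub_lie_jacobi levi_trans).

End PyramidData.

Section Interpolation.
Variables (K : closedFieldType) (V : lmodType K) (S : V -> Prop).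
Hypotheses (S0 : S 0) (SD : forall a x y, S x -> S y -> S (a *: x + y)).

Lemma infinite_field (n : nat) : exists2 s : seq K, size s = n & uniq s.
Proof.
elim: n => [|n [s ss us]]; first by exists [::].
have /closed_nonrootP[x] : \prod_(a <- s) ('X - a%:P) != 0 :> {poly K}.
  by rewrite monic_neq0 // monic_prod_XsubC.
by rewrite root_prod_XsubC => xs; exists (x :: s); rewrite /= ?ss // xs.
Qed.

Lemma interpolate (n : nat) (c : 'I_n -> V) :
  (forall s : K, S (\sum_(k < n) s ^+ k *: c k)) -> forall k, S (c k).
Proof.
move=> H m; have [s ss us] := infinite_field n.
pose a : 'rV[K]_n := \row_j s`_j.
have Vu : Vandermonde n a \in unitmx.
  rewrite unitmxE det_Vandermonde unitfE; apply/prodf_neq0 => i _.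
  apply/prodf_neq0 => j ij; rewrite !mxE subr_eq0 nth_uniq ?ss //.
  by rewrite neq_ltn ij orbT.
pose b := invmx (Vandermonde n a).
have -> : c m = \sum_j b j m *: (\sum_(k < n) (a 0 j) ^+ k *: c k).
  transitivity (\sum_(k < n) (k == m)%:R *: c k).
    rewrite (bigD1 m) //= eqxx scale1r big1 ?addr0 // => k /negPf->.
    by rewrite scale0r.
  under [RHS]eq_bigr do rewrite scaler_sumr.
  rewrite exchange_big /=; apply: eq_bigr => k _.
  under eq_bigr do rewrite scalerA.
  rewrite -scaler_suml; congr (_ *: _).
  have := mulmxV Vu => /matrixP/(_ k m); rewrite !mxE => <-.
  by apply: eq_bigr => j _; rewrite mulrC !mxE.
elim/big_ind: _ => // [x y Sx Sy|j _]; first by rewrite -[x]scale1r; apply: SD.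
by rewrite -[_ *: _]addr0; apply: SD.
Qed.
End Interpolation.

Import mpoly.

Section ZariskiClosed.
Variables (K : fieldType) (N : nat).

Definition zariski_closed (H : 'M[K]_N -> Prop) : Prop :=
  exists S : {mpoly K[N * N]} -> Prop,
    forall g, g \in unitmx ->
      (H g <-> forall f, S f -> f.@[fun k => mxvec g 0 k] = 0).

Definition closed_subgroup (H : 'M[K]_N -> Prop) : Prop :=
  [/\ forall g, H g -> g \in unitmx, H 1%:M,
      forall g h, H g -> H h -> H (g *m h),
      forall g, H g -> H (invmx g) & zariski_closed H].

Lemma closed_subgroup_GL : closed_subgroup (fun g => g \in unitmx).
Proof.
split=> //; first exact: unitmx1.
- by move=> g h Hg Hh; rewrite unitmx_mul Hg.
- by move=> g; rewrite unitmx_inv.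
by exists (fun=> False) => g Hg; split.
Qed.

Definition Ad (g x : 'M[K]_N) : 'M[K]_N := g *m x *m invmx g.

Lemma Ad_hom g : g \in unitmx -> lie_hom (Ad g).
Proof.
move=> Hg; split=> [a x y|x y].
  by rewrite /Ad mulmxDr mulmxDl -scalemxAr -scalemxAl.
rewrite /Ad /lie /= /mxlie mulmxBr mulmxBl.
by congr (_ - _); rewrite !mulmxA mulmxKV.
Qed.
End ZariskiClosed.

Section WAlgebra.
Variables (K : closedFieldType) (N : nat) (pi : pyramid N).
Local Notation row := (row_of pi).
Local Notation col := (col_of pi).
Local Notation Ug := (uea 'M[K]_N).
Local Notation Up := (uea (par pi K)).
Local Notation Uh := (uea (levi pi K)).

Definition nilp_e : 'M[K]_N :=
  \sum_(i < N) \sum_(j < N | (row i == row j) && ((col i).+1 == col j))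
    delta_mx i j.

Definition chi (x : 'M[K]_N) : K := \tr (nilp_e *m x).

(* U(g) m_chi, the left ideal of U(g) generated by x - chi(x), x in m *)
Definition Ug_mchi (w : Ug) : Prop :=
  exists2 s : seq (Ug * 'M[K]_N),
    {in s, forall t, t.2 \in m_space pi K} &
    w = \sum_(t <- s) t.1 * (uea_in t.2 - (chi t.2)%:A).

Definition par_val (x : par pi K) : 'M[K]_N := vsval x.
Definition Up_to_Ug : Up -> Ug := uea_map par_val.

(* The graph of pr: v is the component of w in U(p) for the decomposition
   U(g) = U(g) m_chi (+) U(p), where U(p) is included in U(g) by Up_to_Ug. *)
Definition pr_graph (w : Ug) (v : Up) : Prop := Ug_mchi (w - Up_to_Ug v).

(* smallest closed subgroup containing the root subgroups *)
Definition Mgroup (g : 'M[K]_N) : Prop :=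
  forall H : 'M[K]_N -> Prop, closed_subgroup H ->
    (forall i j s, (col j < col i)%N -> H (1%:M + s *: delta_mx i j)) -> H g.

(* tw(g) . u = v *)
Definition tw_graph (g : 'M[K]_N) (u v : Up) : Prop :=
  pr_graph (uea_map (Ad g) (Up_to_Ug u)) v.

Definition walg_mem : {pred Up} :=
  fun u => `[< forall g, Mgroup g -> tw_graph g u u >].

Lemma Mgroup_unit g : Mgroup g -> g \in unitmx.
Proof.
move=> Hg; apply: (Hg (fun h => h \in unitmx)) => [|i j s ij].
  exact: closed_subgroup_GL.
have ne : j == i = false by apply/eqP => ji; rewrite ji ltnn in ij.
suff /mulmx1_unit[] : (1%:M + s *: delta_mx i j) *m (1%:M - s *: delta_mx i j)
  = 1%:M :> 'M[K]_N by [].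
rewrite mulmxBr mulmx1 mulmxDl mul1mx -scalemxAl -scalemxAr.
by rewrite mul_delta_mx_cond ne mulr0n !scaler0 addr0 addrK.
Qed.

Lemma root_inv i j s : (col j < col i)%N ->
  invmx (1%:M + s *: delta_mx i j) = 1%:M - s *: delta_mx i j :> 'M[K]_N.
Proof.
move=> ij; have ne : j == i = false by apply/eqP => ji; rewrite ji ltnn in ij.
have Hg : (1%:M + s *: delta_mx i j) *m (1%:M - s *: delta_mx i j)
  = 1%:M :> 'M[K]_N.
  rewrite mulmxBr mulmx1 mulmxDl mul1mx -scalemxAl -scalemxAr.
  by rewrite mul_delta_mx_cond ne mulr0n !scaler0 addr0 addrK.
have [Hu _] := mulmx1_unit Hg.
have := congr1 (mulmx (invmx (1%:M + s *: delta_mx i j))) Hg.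
by rewrite mulKmx // mulmx1.
Qed.

Lemma Mgroup_root i j s : (col j < col i)%N -> Mgroup (1%:M + s *: delta_mx i j).
Proof. by move=> ij H _; apply. Qed.

Lemma par_val_hom : lie_hom par_val.
Proof.
split=> [a x y|x y]; first exact: linearP.
exact: (sub_lieE (@par_trans _ pi)).
Qed.

Lemma Up_to_Ug_linear : linear Up_to_Ug.
Proof. exact: uea_lift_linear (uea_map_hom par_val_hom). Qed.

Lemma Up_to_Ug_monoid : monoid_morphism Up_to_Ug.
Proof. exact: uea_lift_monoid (uea_map_hom par_val_hom). Qed.

Lemma Ug_mchi0 : Ug_mchi 0.
Proof. by exists [::]; rewrite ?big_nil. Qed.

Lemma Ug_mchiD w w' : Ug_mchi w -> Ug_mchi w' -> Ug_mchi (w + w').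
Proof.
move=> [s Hs ->] [s' Hs' ->]; exists (s ++ s'); last by rewrite big_cat.
by move=> t; rewrite mem_cat => /orP[/Hs|/Hs'].
Qed.

Lemma Ug_mchiM a w : Ug_mchi w -> Ug_mchi (a * w).
Proof.
move=> [s Hs ->]; exists [seq (a * t.1, t.2) | t <- s].
  by move=> _ /mapP[t /Hs Ht ->].
by rewrite big_map mulr_sumr; apply: eq_bigr => t _; rewrite mulrA.
Qed.

Lemma Ug_mchiZ (a : K) w : Ug_mchi w -> Ug_mchi (a *: w).
Proof. by move=> /(Ug_mchiM (a%:A)); rewrite mulr_algl. Qed.

Lemma Ug_mchi_gen x : x \in m_space pi K -> Ug_mchi (uea_in x - (chi x)%:A).
Proof.
move=> Hx; exists [:: (1, x)]; last by rewrite big_seq1 mul1r.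
by move=> t; rewrite inE => /eqP ->.
Qed.

Lemma chi_linear : scalar chi.
Proof.
by move=> a x y; rewrite /chi mulmxDr -scalemxAr mxtraceD mxtraceZ.
Qed.

Lemma Ad_root_poly i j (w : Ug) : (col j < col i)%N ->
  exists q : {poly Ug},
    [/\ q`_0 = w,
        q`_1 = uea_in (delta_mx i j : 'M[K]_N) * w
               - w * uea_in (delta_mx i j : 'M[K]_N) &
        forall s : K, uea_map (Ad (1%:M + s *: delta_mx i j)) w = q.[s%:A]].
Proof.
move=> ij; set E := uea_in _.
have hom s := uea_map_hom (Ad_hom (Mgroup_unit (Mgroup_root s ij))).
elim/uea_ind: w => [|a x y [p [p0 p1 pE]] [q [q0 q1 qE]]
                    |x y [p [p0 p1 pE]] [q [q0 q1 qE]]|x].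
- exists 1; split=> [||s]; rewrite ?coef1 ?mulr1 ?mul1r ?subrr //.
  by rewrite hornerC; apply: (uea_lift_monoid (hom s)).1.
- exists ((a%:A : Ug) *: p + q); split=> [||s].
  + by rewrite coefD coefZ p0 q0 mulr_algl.
  + rewrite coefD coefZ p1 q1 mulr_algl mulrDr mulrDl scalerBr -scalerAl -scalerAr.
    by rewrite opprD addrACA.
  + rewrite hornerD hornerZ -pE -qE mulr_algl.
    exact: (uea_lift_linear (hom s)).
- exists (p * q); split=> [||s].
  + by rewrite coefM big_ord1 p0 q0.
  + rewrite coefM big_ord_recl big_ord1 /= subn0 subnn p0 p1 q0 q1.
    by rewrite mulrBr mulrBl !mulrA addrC addrA subrK.
  + rewrite hornerM_comm; last by rewrite /comm_poly mulr_algl mulr_algr.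
    by rewrite -pE -qE; apply: (uea_lift_monoid (hom s)).2.
pose D : 'M[K]_N := delta_mx i j.
exists ((uea_in x)%:P + (uea_in (lie D x))%:P * 'X
        - (uea_in (D *m x *m D))%:P * 'X^2); split=> [||s].
- by rewrite !coefE /= !mulr0 addr0 subr0.
- by rewrite !coefE /= !mulr0 subr0 add0r mulr1 uea_in_lie.
rewrite /uea_map uea_liftE // !hornerE /= -!scalerAr !mulr1.
rewrite /Ad root_inv // -/D mulmxBr mulmx1 mulmxDl mul1mx mulmxDl.
rewrite -!scalemxAl -!scalemxAr /lie /= /mxlie.
have -> : ('X^2 : {poly Ug}).[s%:A] = (s * s)%:A.
  by rewrite hornerXn expr2 -scalerAl mul1r scalerA.
rewrite mulr_algr.
transitivity (uea_in (x + s *: (D *m x - x *m D) - (s * s) *: (D *m x *m D))).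
  by congr uea_in; rewrite scalerBr scalerA opprD !addrA.
by rewrite linearB linearD !linearZ.
Qed.

Lemma walg_bracket u : u \in walg_mem -> forall i j, (col j < col i)%N ->
  Ug_mchi (uea_in (delta_mx i j : 'M[K]_N) * Up_to_Ug u
           - Up_to_Ug u * uea_in (delta_mx i j : 'M[K]_N)).
Proof.
move=> /asboolP Hu i j ij; have [q [q0 q1 qE]] := Ad_root_poly (Up_to_Ug u) ij.
rewrite -q1; pose c k := if k == 0%N then 0 else q`_k.
have SD a x y : Ug_mchi x -> Ug_mchi y -> Ug_mchi (a *: x + y).
  by move=> Hx Hy; apply: Ug_mchiD => //; apply: Ug_mchiZ.
have lt1 : (1 < (size q).+2)%N by [].
suff H : forall s : K, Ug_mchi (\sum_(k < (size q).+2) s ^+ k *: c k).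
  exact: (interpolate Ug_mchi0 SD H (Ordinal lt1)).
move=> s; have := Hu _ (Mgroup_root s ij); rewrite /tw_graph /pr_graph qE.
suff -> : q.[s%:A] - Up_to_Ug u = \sum_(k < (size q).+2) s ^+ k *: c k by [].
have szq : (size q <= (size q).+2)%N by apply: leq_trans (leqnSn _) (leqnSn _).
rewrite (horner_coef_wide _ szq).
rewrite big_ord_recl [RHS]big_ord_recl /=.
rewrite expr0 mulr1 q0.
rewrite addrC addKr.
rewrite /c eqxx scaler0 add0r; apply: eq_bigr => k _ /=.
by rewrite exprZn expr1n mulr_algr.
Qed.

Lemma walg_mchi u w : u \in walg_mem -> Ug_mchi w -> Ug_mchi (w * Up_to_Ug u).
Proof.
move=> Hu [s Hs ->]; rewrite mulr_suml big_seq.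
elim/big_ind: _ => [||[a x] /Hs /= Hx]; [exact: Ug_mchi0|exact: Ug_mchiD|].
rewrite -mulrA; apply: Ug_mchiM.
have -> : uea_in x - (chi x)%:A = \sum_i \sum_j x i j *:
    (uea_in (delta_mx i j : 'M[K]_N) - (chi (delta_mx i j))%:A).
  pose f (y : 'M[K]_N) : Ug := uea_in y - (chi y)%:A.
  have flin : linear f.
    move=> b y z; rewrite /f linearP chi_linear scalerDl -scalerA scalerBr.
    by rewrite opprD addrACA.
  pose fl : {linear 'M[K]_N -> Ug} :=
    HB.pack f (GRing.isLinear.Build K 'M[K]_N Ug *:%R f flin).
  rewrite -[LHS]/(fl x) {1}[x]matrix_sum_delta linear_sum.
  apply: eq_bigr => i _; rewrite linear_sum; apply: eq_bigr => j _.
  by rewrite linearZ.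
rewrite mulr_suml; elim/big_ind: _ => [||i _]; [exact: Ug_mchi0|exact: Ug_mchiD|].
rewrite mulr_suml; elim/big_ind: _ => [||j _]; [exact: Ug_mchi0|exact: Ug_mchiD|].
rewrite -scalerAl; have [ij|ij] := boolP (col j < col i)%N; last first.
  by move/mem_unit_span: Hx => /(_ _ _ ij) ->; rewrite scale0r; apply: Ug_mchi0.
apply: Ug_mchiZ; set E := uea_in _; set v := Up_to_Ug u.
have -> : (E - (chi (delta_mx i j))%:A) * v
        = v * (E - (chi (delta_mx i j))%:A) + (E * v - v * E).
  rewrite mulrBl mulrBr mulr_algl mulr_algr [RHS]addrC [RHS]addrA subrK.
  by [].
apply: Ug_mchiD; last exact: walg_bracket.
apply: Ug_mchiM; apply: Ug_mchi_gen; apply/mem_unit_span => a' b' nab.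
rewrite mxE; case: eqP => //= ai; case: eqP => //= bj.
by rewrite ai bj ij in nab.
Qed.

Lemma walg_closed : GRing.subalg_closed walg_mem.
Proof.
have homg g (Hg : Mgroup g) := uea_map_hom (Ad_hom (Mgroup_unit Hg)).
split=> [|a u v Hu Hv|u v Hu Hv]; apply/asboolP => g Hg; rewrite /tw_graph /pr_graph.
- rewrite Up_to_Ug_monoid.1 (_ : uea_map _ 1 = 1) ?subrr; first exact: Ug_mchi0.
  exact: (uea_lift_monoid (homg g Hg)).1.
- rewrite !Up_to_Ug_linear (_ : uea_map _ _ = a *: uea_map (Ad g) (Up_to_Ug u)
    + uea_map (Ad g) (Up_to_Ug v)); last exact: (uea_lift_linear (homg g Hg)).
  rewrite opprD addrACA -scalerBr; apply: Ug_mchiD; first apply: Ug_mchiZ.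
    by move/asboolP: Hu; apply.
  by move/asboolP: Hv; apply.
rewrite !Up_to_Ug_monoid.2 (_ : uea_map _ _ = uea_map (Ad g) (Up_to_Ug u)
    * uea_map (Ad g) (Up_to_Ug v)); last exact: (uea_lift_monoid (homg g Hg)).2.
set gu := uea_map _ _; set gv := uea_map _ _.
have -> : gu * gv - Up_to_Ug u * Up_to_Ug v
  = gu * (gv - Up_to_Ug v) + (gu - Up_to_Ug u) * Up_to_Ug v.
  by rewrite mulrBr mulrBl addrA subrK.
apply: Ug_mchiD; first by apply: Ug_mchiM; move/asboolP: Hv; apply.
by apply: walg_mchi => //; move/asboolP: Hu; apply.
Qed.

HB.instance Definition _ := GRing.isSubalgClosed.Build K Up walg_mem walg_closed.

Record walg : predArgType := Walg { walg_val : Up; _ : walg_val \in walg_mem }.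
HB.instance Definition _ := [isSub for walg_val].
HB.instance Definition _ := [Choice of walg by <:].
HB.instance Definition _ := [SubChoice_isSubAlgebra of walg by <:].
End WAlgebra.

Section RestrictedWAlgebra.
Variables (K : closedFieldType) (N : nat) (pi : pyramid N).
Local Notation Up := (uea (par pi K)).

(* x^[p] is the p-th power of the matrix x *)
Definition par_ppow (p : nat) (x : par pi K) : par pi K :=
  vsproj (par_space pi K) (vsval x ^+ p).

Lemma par_ppowE (p : nat) (x : par pi K) : (0 < p)%N ->
  vsval (par_ppow p x) = vsval x ^+ p.
Proof.
case: p => // p _; rewrite vsprojK //; elim: p => [|p IH]; first exact: subvsP.
by rewrite exprS; apply: unit_span_mul IH; [exact: par_trans|exact: subvsP].
Qed.

Definition J0 (p : nat) : Up -> Prop :=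
  ideal_gen (fun u =>
    exists x : par pi K, u = uea_in x ^+ p - uea_in (par_ppow p x)).

Definition J0_walg (p : nat) (u : walg K pi) : Prop := J0 p (val u).

Lemma J0_walg_ideal (p : nat) : ideal2 (J0_walg p).
Proof.
have [J00 JB JMl JMr] := ideal_gen_ideal2
  (fun u : Up => exists x : par pi K, u = uea_in x ^+ p - uea_in (par_ppow p x)).
split=> [|u v Hu Hv|a u Hu|a u Hu]; rewrite /J0_walg.
- by rewrite raddf0.
- by rewrite raddfB; apply: JB.
- by rewrite rmorphM; apply: JMl.
- by rewrite rmorphM; apply: JMr.
Qed.

Lemma J0_kill (p : nat) (F : {lrmorphism Up -> K^o}) : (0 < p)%N ->
  (forall x, F (uea_in x) = 0) -> forall u, J0 p u -> F u = 0.
Proof.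
move=> p0 FE u Hu; apply: (Hu (fun v => F v = 0)) => [|_ [x ->]].
  split=> [|x y|a x|a x]; rewrite ?raddf0 ?raddfB ?rmorphM //=.
  - by move=> -> ->; rewrite subr0.
  - by move=> ->; rewrite mulr0.
  - by move=> ->; rewrite mul0r.
by rewrite raddfB /= rmorphXn /= !FE expr0n (gtn_eqF p0) subr0.
Qed.

Lemma J0_proper (p : nat) : (0 < p)%N -> ~ J0 p 1.
Proof.
pose f (x : par pi K) : K^o := 0.
have fH : lie_hom_to_alg f.
  by split=> [a x y|x y]; rewrite /f ?scaler0 ?addr0 // mulr0 subr0.
pose F : {lrmorphism Up -> K^o} := HB.pack (uea_lift f)
  (GRing.isLinear.Build K Up K^o *:%R _ (uea_lift_linear fH))
  (GRing.isMonoidMorphism.Build Up K^o _ (uea_lift_monoid fH)).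
move=> p0 /(J0_kill (F := F) p0) H.
have /eqP : F 1 = 0 by apply: H => x; rewrite /F /= uea_liftE.
by rewrite rmorph1 oner_eq0.
Qed.

Variables (p : nat) (charK : p \in [pchar K]).

Fact J0_walg_proper : ~ J0_walg p 1.
Proof.
rewrite /J0_walg rmorph1.
by apply/J0_proper/prime_gt0/(pcharf_prime charK).
Qed.

Definition rwalg : algType K :=
  quot_alg (ProperIdeal2 (J0_walg_ideal p) J0_walg_proper).

Definition to_rwalg : walg K pi -> rwalg := quot_pi _.

Definition factors_to_rwalg (phi : walg K pi -> K^o) : Prop :=
  exists psi : {lrmorphism rwalg -> K^o}, forall u, psi (to_rwalg u) = phi u.

End RestrictedWAlgebra.

Section Tableaux.
Variables (K : closedFieldType) (N : nat) (pi : pyramid N).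
Local Notation Up := (uea (par pi K)).
Local Notation Uh := (uea (levi pi K)).
Implicit Types A : {ffun 'I_N -> K}.

Definition column_connected A : Prop :=
  forall i j, directly_above pi i j -> A i = A j + 1.

Definition Fp_tableau (p : nat) A : Prop :=
  exists B : {ffun 'I_N -> 'F_p}, forall i, A i = (nat_of_ord (B i))%:R.

Definition rho (i : 'I_N) : K :=
  (nrows pi)%:R - \sum_(col_of pi i <= c < (ncols pi).+1) (height pi c)%:R
  - (row_of pi i)%:R.

Definition weight A (i : 'I_N) : K := A i - rho i.

(* The weight on diagonal matrices, extended by zero to off-diagonal elements
   of h: these are brackets in h. *)
Definition levi_char A (x : levi pi K) : K^o :=
  \sum_(i < N) weight A i * (vsval x : 'M_N) i i.

Definition levi_proj (x : par pi K) : levi pi K :=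
  vsproj (levi_space pi K)
    (\matrix_(i, j) if col_of pi i == col_of pi j then (vsval x : 'M_N) i j else 0).

(* The one-dimensional modules are given by their characters: u acts on K as
   multiplication by the value at u. *)
Definition ktilde_levi A : Uh -> K^o := uea_lift (levi_char A).
Definition ktilde A (u : Up) : K^o := ktilde_levi A (uea_map levi_proj u).
Definition ktilde_bar A (u : walg K pi) : K^o := ktilde A (val u).

Lemma levi_projE (x : par pi K) i j : (vsval (levi_proj x) : 'M_N) i j =
  if col_of pi i == col_of pi j then (vsval x : 'M_N) i j else 0.
Proof.
rewrite vsprojK ?mxE //; apply/mem_unit_span => a b /negPf nab.
by rewrite mxE nab.
Qed.

Lemma levi_proj_hom : lie_hom levi_proj.
Proof.
have lE (x y : levi pi K) : vsval (lie x y) = mxlie (vsval x) (vsval y).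
  exact: (sub_lieE (@levi_trans _ pi)).
have pE (x y : par pi K) : vsval (lie x y) = mxlie (vsval x) (vsval y).
  exact: (sub_lieE (@par_trans _ pi)).
have H (x y : par pi K) (i j : 'I_N) :
    ((vsval (levi_proj x) : 'M_N) *m vsval (levi_proj y)) i j =
    if col_of pi i == col_of pi j then ((vsval x : 'M_N) *m vsval y) i j else 0.
  rewrite !mxE; case: eqP => [cij|cij].
    apply: eq_bigr => k _; rewrite !levi_projE -cij.
    rewrite [X in _ * if X then _ else _]eq_sym.
    case: eqP => [//|/eqP cik]; rewrite mul0r.
    have /mem_unit_span Hx := subvsP x; have /mem_unit_span Hy := subvsP y.
    case: (ltngtP (col_of pi i) (col_of pi k)) cik => // lik _.
      by rewrite Hy ?mulr0 // -cij -ltnNge.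
    by rewrite Hx ?mul0r // -ltnNge.
  rewrite big1 // => k _; rewrite !levi_projE.
  have [cik|_] := eqVneq (col_of pi i) (col_of pi k); last by rewrite mul0r.
  have [ckj|_] := eqVneq (col_of pi k) (col_of pi j); last by rewrite mulr0.
  by rewrite cik ckj in cij.
split=> [a x y|x y]; apply: val_inj; apply/matrixP=> i j /=.
  change ((vsval (levi_proj (a *: x + y)) : 'M_N) i j
    = (vsval (a *: levi_proj x + levi_proj y) : 'M_N) i j).
  have -> : vsval (a *: levi_proj x + levi_proj y)
      = a *: vsval (levi_proj x) + vsval (levi_proj y) by exact: linearP.
  rewrite !mxE !levi_projE.
  have -> : vsval (a *: x + y) = a *: vsval x + vsval y by exact: linearP.
  by case: eqP; rewrite ?mxE ?mulr0 ?addr0.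
change ((vsval (levi_proj (lie x y)) : 'M_N) i j
  = (vsval (lie (levi_proj x) (levi_proj y)) : 'M_N) i j).
have mB (P Q : 'M[K]_N) : (P - Q) i j = P i j - Q i j by rewrite !mxE.
by rewrite lE levi_projE pE /mxlie !mB !H; case: eqP => // _; rewrite subrr.
Qed.

Lemma weight_above A : column_connected A ->
  forall i j, directly_above pi i j -> weight A i = weight A j.
Proof.
move=> HA i j ij; rewrite /weight /rho (HA _ _ ij); have [<- <-] := ij.
by rewrite -[in RHS]natr1; ring.
Qed.

Lemma weight_const A : column_connected A ->
  forall i j, col_of pi i = col_of pi j -> weight A i = weight A j.
Proof. by move=> HA; apply: const_on_columns; apply: weight_above. Qed.

Lemma levi_char_hom A : column_connected A -> lie_hom_to_alg (levi_char A).
Proof.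
move=> HA; split=> [a x y|x y].
  rewrite /levi_char.
  have -> : vsval (a *: x + y) = a *: vsval x + vsval y by exact: linearP.
  rewrite scaler_sumr -big_split; apply: eq_bigr => i _ /=.
  by rewrite !mxE mulrDr mulrCA.
have -> : levi_char A x * levi_char A y - levi_char A y * levi_char A x = 0.
  by rewrite [X in X - _]mulrC subrr.
rewrite /levi_char [vsval _](sub_lieE (@levi_trans _ pi)) /lie /= /mxlie.
under eq_bigr do rewrite !mxE mulrBr !mulr_sumr.
rewrite sumrB [X in _ - X]exchange_big /= -sumrB big1 // => i _.
rewrite -sumrB big1 // => j _.
have /mem_unit_span Hx := subvsP x.
have [/eqP cij|/Hx->] := boolP (col_of pi i == col_of pi j); last first.
  by rewrite !(mul0r, mulr0) subrr.
by rewrite (weight_const HA cij) [X in _ - _ * X]mulrC subrr.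
Qed.

Lemma ktilde_linear A : column_connected A -> linear (ktilde A).
Proof.
move=> HA a u v; rewrite /ktilde /ktilde_levi.
by rewrite /uea_map (uea_lift_linear (uea_map_hom levi_proj_hom))
  (uea_lift_linear (levi_char_hom HA)).
Qed.

Lemma ktilde_monoid A : column_connected A -> monoid_morphism (ktilde A).
Proof.
have [p1 pM] := uea_lift_monoid (uea_map_hom levi_proj_hom).
move=> HA; have [l1 lM] := uea_lift_monoid (levi_char_hom HA).
split=> [|u v]; rewrite /ktilde /ktilde_levi /uea_map; first by rewrite p1 l1.
by rewrite pM lM.
Qed.

Lemma ktildeE A (x : par pi K) : column_connected A ->
  ktilde A (uea_in x) = \sum_(i < N) weight A i * (vsval x : 'M_N) i i.
Proof.
move=> HA; rewrite /ktilde /uea_map (uea_liftE (uea_map_hom levi_proj_hom)).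
rewrite /ktilde_levi (uea_liftE (levi_char_hom HA)); apply: eq_bigr => i _.
by rewrite levi_projE eqxx.
Qed.

End Tableaux.

Arguments factors_to_rwalg {K N} pi {p} charK phi.
Arguments ktilde_bar {K N} pi A u.

(* Main.v *)
Require Import Defs.
From mathcomp Require Import all_boot all_order all_algebra.
From HB Require Import structures.
From mathcomp Require Import perm boolp.
From mathcomp.multinomials Require mpoly.
Import GRing.Theory.
Local Open Scope ring_scope.

Set Implicit Arguments.
Unset Strict Implicit.
Unset Printing Implicit Defensive.

(** Let w_i be the weight [weight pi A i]; as rho has entries in F_p, A is a
tableau over F_p iff w_i^p = w_i for all i.

By Jacobson's formula x |-> x^p - x^[p] is p-semilinear with central values, so
the character sends x^p - x^[p], x in p, to zero as soon as it does so for the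
matrix units of p; on e_{i,i} its value is w_i^p - w_i. This gives one
direction.

For the other one, let E be the matrix of central elements
e_{i,j}^p - e_{i,j}^[p] of U(g). Semilinearity shows that g in GL_N acts on E by
conjugation with a Frobenius twist, so det(t - E) is invariant. Modulo
U(g) m_chi the entries of E below the block diagonal become the scalars
chi(e_{i,j})^p, so det(t - E) projects to the element eta_det t of U(p), which
thus lies in U(g,e). Modulo J_0^p it is the determinant of a triangular matrix
with diagonal t, so eta_det t - t^N is in J_0^p; its image under the character is
prod_i (t - (w_i^p - w_i)) - t^N. If the character factors this vanishes for all
t, and t = w_i^p - w_i gives t^N = 0. *)

(** * Powers of inner derivations in characteristic p *)

Section AdjointPower.
Variable R : nzRingType.
Implicit Types a b : R.

Definition ad a b := a * b - b * a.

(** Left and right multiplication by [a] commute, so this is the binomial expansion of the n-th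
    power of their difference. *)
Lemma iter_ad n a b :
  iter n (ad a) b =
  \sum_(i < n.+1) (-1) ^+ i * (a ^+ (n - i) * b * a ^+ i) *+ 'C(n, i).
Proof.
elim: n => [|n IH]; first by rewrite big_ord1 /= !expr0 !mul1r mulr1.
rewrite iterS {}IH /ad mulr_sumr mulr_suml.
rewrite big_ord_recl [X in _ - X]big_ord_recr [RHS]big_ord_recl [in RHS]big_ord_recr /=.
rewrite !subnn !bin0 !binn !subn0 !expr0 !mul1r !mulr1 !mulr1n.
rewrite -!addrA; congr (_ + _); first by rewrite mulrA exprS.
rewrite opprD !addrA; congr (_ + _); last first.
  by rewrite /bump /= add1n exprS mulN1r mulNr -!mulrA -exprSr.
rewrite -sumrB; apply: eq_bigr => i _ /=; rewrite /bump /= !add1n subSS binS mulrnDr.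
congr (_ + _).
  rewrite mulrnAr !mulrA; congr (_ *+ _).
  by rewrite (commr_sign a) -(subnSK (ltn_ord i)) [a ^+ (_ - _).+1]exprS -!mulrA.
by rewrite mulrnAl -mulNrn exprS mulN1r mulNr -!mulrA -exprSr.
Qed.

Section CharP.
Variables (p : nat) (charR : p \in [pchar R]).

Let p_pr : prime p := pcharf_prime charR.

(** By Pascal's rule consecutive ['C(p.-1, i)] add up to some ['C(p, i.+1)], which vanishes in
    characteristic p; hence they alternate in sign. *)
Lemma sign_bin_pred_pchar i : (i < p)%N ->
  (-1) ^+ i *+ 'C(p.-1, i) = 1 :> R.
Proof.
elim: i => [|i IH] lip; first by rewrite expr0 bin0.
have := bin_lt_pcharf_0 charR (k := i.+1) lip.
rewrite -{1}(prednK (prime_gt0 p_pr)) binS natrD => /eqP; rewrite addr_eq0 => /eqP E.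
by rewrite -mulr_natr E exprS mulN1r mulrNN mulr_natr IH // ltnW.
Qed.

Lemma iter_ad_pred_pchar a b :
  iter p.-1 (ad a) b = \sum_(i < p) a ^+ (p.-1 - i) * b * a ^+ i.
Proof.
rewrite iter_ad (prednK (prime_gt0 p_pr)); apply: eq_bigr => i _.
by rewrite -mulrnAl sign_bin_pred_pchar ?mul1r.
Qed.

(** One further bracket with [a] makes the sum of [iter_ad_pred_pchar] telescope. *)
Lemma iter_ad_pchar a b : iter p (ad a) b = a ^+ p * b - b * a ^+ p.
Proof.
rewrite -{1}(prednK (prime_gt0 p_pr)) iterS iter_ad_pred_pchar /ad.
case: p (prime_gt0 p_pr) => // m _.
rewrite mulr_sumr mulr_suml big_ord_recl [X in _ - X]big_ord_recr /=.
rewrite subn0 subnn expr0 mul1r mulr1 mulrA -exprS -mulrA -exprSr.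
rewrite opprD addrA; congr (_ + _); rewrite -[RHS]addr0 -addrA; congr (_ + _).
rewrite -sumrB big1 // => i _; rewrite /bump /= add1n.
by rewrite !mulrA -exprS subnSK // -!mulrA -exprSr subrr.
Qed.

End CharP.
End AdjointPower.

(** * Jacobson's formula for the p-th power of a sum *)

Lemma deriv_exp (R : nzRingType) (P : {poly R}) n :
  (P ^+ n)^`() = \sum_(i < n) P ^+ (n.-1 - i) * P^`() * P ^+ i.
Proof.
elim: n => [|n IH]; first by rewrite big_ord0 expr0 derivC.
rewrite exprS derivM IH big_ord_recr /= subnn expr0 mul1r addrC; congr (_ + _).
rewrite mulr_sumr; apply: eq_bigr => i _; rewrite !mulrA -exprS; congr (_ ^+ _ * _ * _).
by case: n i {IH} => [[]|n i] //=; rewrite subSn // -ltnS.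
Qed.

Section Jacobson.
Variables (K : fieldType) (p : nat) (charK : p \in [pchar K]).
Variables (L : lieAlgType K) (x y : L).

(* The coefficient of t^i in ad(t x + y)^n (x). *)
Fixpoint ad_pencil_coef (n i : nat) : L :=
  if n is m.+1 then
    (if i is j.+1 then lie x (ad_pencil_coef m j) else 0) + lie y (ad_pencil_coef m i)
  else if i == 0%N then x else 0.

(** The sum of Jacobson's Lie polynomials. It is formed inside [L], so that the same element serves
    every homomorphism out of [L]. *)
Definition jacobson_sum : L :=
  \sum_(0 <= i < p.-1) i.+1%:R^-1 *: ad_pencil_coef p.-1 i.

Variables (A : algType K) (f : L -> A) (fH : lie_hom_to_alg f).

Let P : {poly A} := (f x)%:P * 'X + (f y)%:P.

Let charA : p \in [pchar A].
Proof. exact: (rmorph_pchar (in_alg A)). Qed.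

Let f0 : f 0 = 0.
Proof. by have := fH.1 (-1) 0 0; rewrite scaler0 addr0 scaleN1r addNr. Qed.

Let fD u v : f (u + v) = f u + f v.
Proof. by have := fH.1 1 u v; rewrite !scale1r. Qed.

Let fZ a u : f (a *: u) = a *: f u.
Proof. by have := fH.1 a u 0; rewrite f0 !addr0. Qed.

Let coef_ad n i : (iter n (ad P) (f x)%:P)`_i = f (ad_pencil_coef n i).
Proof.
elim: n i => [|n IH] i; first by rewrite coefC /=; case: eqP; rewrite ?f0.
rewrite iterS /ad /P mulrDl mulrDr -!mulrA -(commr_polyX (iter _ _ _)) !mulrA.
rewrite !(coefB, coefD, coefMX, coefCM, coefMC) /= fD.
case: i => [|i] /=; rewrite !IH fH.2; last first.
  by rewrite fH.2 opprD addrACA.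
by rewrite f0 !add0r.
Qed.

Let coef_exp n : [/\ (P ^+ n)`_0 = f y ^+ n, (P ^+ n)`_n = f x ^+ n &
  forall i, (n < i)%N -> (P ^+ n)`_i = 0].
Proof.
have PX Q i : (P * Q)`_i = f x * (if i is j.+1 then Q`_j else 0) + f y * Q`_i.
  rewrite /P mulrDl coefD coefCM -mulrA -(commr_polyX Q) coefCM coefMX.
  by case: i.
elim: n => [|n [IH0 IHn IHb]].
  by rewrite !expr0 !coef1; split=> // -[|i] //; rewrite coef1.
rewrite exprS; split; rewrite ?PX ?IH0 ?IHn ?IHb ?mulr0 ?add0r ?addr0 -?exprS //.
case=> // i ni; rewrite exprS PX !IHb ?mulr0 ?addr0 // ltnW //.
Qed.

(** By [deriv_exp] and [iter_ad_pred_pchar] the derivative of [P ^+ p], where [P] is tx + y, equals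
    ad(P)^(p-1)(x). Dividing by i+1, which is invertible for i < p-1, recovers the coefficients of
    [P ^+ p] strictly between degrees 0 and p; then t = 1. *)
Lemma jacobson : f (x + y) ^+ p = f x ^+ p + f y ^+ p + f jacobson_sum.
Proof.
have p_pr := pcharf_prime charK; have [c0 cp cb] := coef_exp p.
have D : (P ^+ p)^`() = iter p.-1 (ad P) (f x)%:P.
  rewrite deriv_exp (iter_ad_pred_pchar (p := p)); last by rewrite pchar_poly.
  suff -> : P^`() = (f x)%:P by [].
  by rewrite /P derivD derivM !derivC derivX mul0r add0r mulr1 addr0.
have ci i : (i < p.-1)%N ->
    (P ^+ p)`_i.+1 = f (i.+1%:R^-1 *: ad_pencil_coef p.-1 i).
  move=> lti; have n0 : i.+1%:R != 0 :> K.
    rewrite -(dvdn_pcharf charK) gtnNdvd //.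
    by rewrite -[X in (_ < X)%N](prednK (prime_gt0 p_pr)) ltnS.
  rewrite fZ -coef_ad -D coef_deriv -scaler_nat scalerA mulVf // scale1r.
  by [].
have sP : (size (P ^+ p) <= p.+1)%N by apply/leq_sizeP => i /cb.
have cP1 : comm_poly P 1 by rewrite /comm_poly mulr1 mul1r.
have <- : (P ^+ p).[1] = f (x + y) ^+ p.
  by rewrite horner_exp_comm // /P hornerD hornerMX !hornerC mulr1 fD.
rewrite (horner_coef_wide _ sP).
under eq_bigr do rewrite expr1n mulr1.
rewrite -(big_mkord xpredT (fun i => (P ^+ p)`_i)) big_nat_recl //.
rewrite -[X in \big[_/_]_(_ <= _ < X) _](prednK (prime_gt0 p_pr)).
rewrite big_nat_recr //= (prednK (prime_gt0 p_pr)).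
rewrite c0 cp addrA addrAC [f y ^+ p + _]addrC; congr (_ + _).
rewrite /jacobson_sum (big_morph f fD f0) !big_nat.
by apply: eq_bigr => i /andP[_ /ci].
Qed.

End Jacobson.

(** * Semilinearity and centrality of x^p - x^[p] *)

(* p-maps are given through a faithful associative envelope g : L -> B, in which
   they are the p-th power. *)
Section RestrictedLieAlgebra.
Variables (K : fieldType) (p : nat) (charK : p \in [pchar K]).
Variables (L : lieAlgType K) (B : algType K) (g : L -> B) (ppow : L -> L).
Hypotheses (gH : lie_hom_to_alg g) (g_inj : injective g).
Hypothesis ppowE : forall x, g (ppow x) = g x ^+ p.

Let lie_hom_iter (A : algType K) (f : L -> A) : lie_hom_to_alg f ->
  forall n x y, f (iter n (lie x) y) = iter n (ad (f x)) (f y).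
Proof. by move=> fH; elim=> //= n IH x y; rewrite fH.2 IH. Qed.

Let pchar_alg (A : algType K) : p \in [pchar A].
Proof. exact: (rmorph_pchar (in_alg A)). Qed.

Let homD (A : algType K) (f : L -> A) : lie_hom_to_alg f ->
  {morph f : x y / x + y}.
Proof. by move=> fH x y; have := fH.1 1 x y; rewrite !scale1r. Qed.

Let homZ (A : algType K) (f : L -> A) : lie_hom_to_alg f -> scalable f.
Proof.
move=> fH a x; have f0 : f 0 = 0.
  by have := fH.1 (-1) 0 0; rewrite scaler0 addr0 scaleN1r addNr.
by have := fH.1 a x 0; rewrite f0 !addr0.
Qed.

Lemma lie_ppow x y : lie (ppow x) y = iter p (lie x) y.
Proof.
by apply: g_inj; rewrite gH.2 lie_hom_iter // (iter_ad_pchar (pchar_alg B)) ppowE.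
Qed.

Lemma ppowD x y : ppow (x + y) = ppow x + ppow y + jacobson_sum p x y.
Proof.
by apply: g_inj; rewrite !homD // !ppowE homD // -(jacobson charK _ _ gH) homD.
Qed.

Lemma ppowZ a x : ppow (a *: x) = a ^+ p *: ppow x.
Proof. by apply: g_inj; rewrite homZ // !ppowE homZ // exprZn. Qed.

Variables (A : algType K) (f : L -> A) (fH : lie_hom_to_alg f).

Definition pdefect (x : L) : A := f x ^+ p - f (ppow x).

(** Jacobson's correction is the same element of [L] for the p-th power in [A] and for [ppow], hence
    cancels. *)
Lemma pdefectD : {morph pdefect : x y / x + y}.
Proof.
move=> x y; rewrite /pdefect (jacobson charK _ _ fH) ppowD !homD //.
by rewrite opprD addrACA subrr addr0 opprD addrACA.
Qed.

Lemma pdefectZ a x : pdefect (a *: x) = a ^+ p *: pdefect x.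
Proof. by rewrite /pdefect ppowZ !homZ // exprZn scalerBr. Qed.

Lemma pdefect0 : pdefect 0 = 0.
Proof. by apply: (addrI (pdefect 0)); rewrite -pdefectD !addr0. Qed.

(** Commutation with [f x ^+ p] and with [f (ppow x)] both give the image of ad(x)^p(y). *)
Lemma pdefect_comm x y : pdefect x * f y = f y * pdefect x.
Proof.
have E : f x ^+ p * f y - f y * f x ^+ p
    = f (ppow x) * f y - f y * f (ppow x).
  by rewrite -(iter_ad_pchar (pchar_alg A)) -lie_hom_iter // -lie_ppow fH.2.
move/eqP: E; rewrite subr_eq => /eqP E; rewrite /pdefect mulrBl E mulrBr.
by rewrite addrAC [X in X + _]addrAC subrr add0r addrC.
Qed.

End RestrictedLieAlgebra.

(** * The centre of an algebra *)

Section Centre.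
Variables (K : fieldType) (A : algType K).

Definition centre_mem : {pred A} := fun x => `[< forall y, x * y = y * x >].

Lemma centre_closed : GRing.subalg_closed centre_mem.
Proof.
split=> [|a x y /asboolP Hx /asboolP Hy|x y /asboolP Hx /asboolP Hy];
  apply/asboolP => z; first by rewrite mul1r mulr1.
- by rewrite mulrDl mulrDr -scalerAl -scalerAr Hx Hy.
- by rewrite -mulrA Hy !mulrA Hx.
Qed.

HB.instance Definition _ :=
  GRing.isSubalgClosed.Build K A centre_mem centre_closed.

(** A type of its own, so that matrices of central elements live over a commutative ring, where
    determinants are multiplicative. *)
Record centre : predArgType := Centre { centre_val : A; _ : centre_val \in centre_mem }.
HB.instance Definition _ := [isSub for centre_val].
HB.instance Definition _ := [Choice of centre by <:].
HB.instance Definition _ := [SubChoice_isSubAlgebra of centre by <:].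

Lemma centre_valC (x : centre) (y : A) : val x * y = y * val x.
Proof. by case: x => x /= /asboolP. Qed.

Fact centre_mulC : commutative (@GRing.mul centre).
Proof. by move=> x y; apply: val_inj; rewrite !rmorphM; apply: centre_valC. Qed.
HB.instance Definition _ :=
  GRing.PzRing_hasCommutativeMul.Build centre centre_mulC.

End Centre.

Arguments centre_mem {K} A _.

(** * Determinants of triangular matrices and modulo a left ideal *)

Section Determinants.

(** A permutation contributes only if it strictly lowers [c] at every index it moves. Unless it is
    the identity, this would lower the sum of all [c i], which a permutation preserves. *)
Lemma det_trig_by (R : comNzRingType) n (c : 'I_n -> nat) (M : 'M[R]_n) :
    (forall i j, i != j -> (c i <= c j)%N -> M i j = 0) ->
  \det M = \prod_i M i i.
Proof.
move=> HM; rewrite /determinant (bigD1 (1%g : 'S_n)) //= odd_perm1 expr0 mul1r.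
rewrite [X in _ + X]big1 ?addr0 => [|s s1]; first by apply: eq_bigr => i _; rewrite perm1.
suff [i si ci] : exists2 i, i != s i & (c i <= c (s i))%N.
  by rewrite (bigD1 i) //= HM // mul0r mulr0.
apply: contrapT => noH.
have H i : i != s i -> (c i <= c (s i))%N -> False by move=> *; apply: noH; exists i.
have lt i : i != s i -> (c (s i) < c i)%N.
  by move=> si; rewrite ltnNge; apply/negP => ci; apply: (H i).
have le i : (c (s i) <= c i)%N.
  by have [<-//|/lt/ltnW] := eqVneq i (s i).
have [i si] : exists i, i != s i.
  apply/existsP; apply: contraNT s1 => /existsPn s1; apply/eqP/permP => i.
  by rewrite perm1; have /negPn/eqP <- := s1 i.
have : (\sum_i c (s i) < \sum_i c i)%N.
  rewrite (bigD1 i) //= [ltnRHS](bigD1 i) //= -addSn leq_add ?lt //.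
  by apply: leq_sum => j _; apply: le.
by rewrite [ltnRHS](reindex_inj (@perm_inj _ s)) ltnn.
Qed.

Variables (R : nzRingType) (J : R -> Prop).
Hypotheses (J0 : J 0) (JD : forall x y, J x -> J y -> J (x + y))
  (JM : forall a x, J x -> J (a * x)).

(** Products are compared factor by factor. The error in each factor must end up on the right to
    stay in the left ideal [J], so the centrality of the partial products of [M'] is carried through
    the induction. *)
Lemma det_congr_left_ideal n (M M' : 'M[R]_n) :
    (forall i j x, M' i j * x = x * M' i j) ->
    (forall i j, J (M i j - M' i j)) ->
  J (\det M - \det M').
Proof.
move=> M'C MM'; rewrite /determinant -sumrB; elim/big_ind: _ => // s _.
rewrite -mulrBr; apply: JM.
suff [_] : (forall x, (\prod_i M' i (s i)) * x = x * \prod_i M' i (s i)) /\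
    J (\prod_i M i (s i) - \prod_i M' i (s i)) by [].
elim/big_rec2: _ => [|i a b _ [bC Jab]].
  by rewrite subrr; split=> // x; rewrite mulr1 mul1r.
split=> [x|]; first by rewrite -mulrA bC mulrA M'C mulrA.
rewrite [X in J X](_ : _ = M i (s i) * (a - b) + b * (M i (s i) - M' i (s i))).
  by apply: JD; apply: JM.
by rewrite !mulrBr !bC addrA subrK.
Qed.

End Determinants.

(** Otherwise [x] and the p elements of the prime field would be p+1 roots of X^p - X. *)
Lemma pfix_natr (K : fieldType) p (charK : p \in [pchar K]) (x : K) :
  x ^+ p = x -> exists2 n, (n < p)%N & x = n%:R.
Proof.
move=> xp; have p_pr := pcharf_prime charK.
apply: contrapT => Hx; pose s := x :: [seq n%:R | n <- iota 0 p] : seq K.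
have us : uniq s.
  rewrite cons_uniq; apply/andP; split.
    by apply/mapP => -[n]; rewrite mem_iota => /= np xE; apply: Hx; exists n.
  have aux m n : (m <= n)%N -> (n < p)%N -> m%:R = n%:R :> K -> m = n.
    move=> mn np /eqP; rewrite eq_sym -subr_eq0 -natrB // -(dvdn_pcharf charK).
    move=> pnm; apply/eqP; rewrite eqn_leq mn /= -subn_eq0.
    by move: pnm; rewrite /dvdn modn_small ?(leq_ltn_trans (leq_subr _ _)).
  rewrite map_inj_in_uniq ?iota_uniq // => m n; rewrite !mem_iota /= => mp np e.
  by case/orP: (leq_total m n) => /aux H; [|symmetry]; apply: H.
have sQ : size ('X^p - 'X : {poly K}) = p.+1.
  by rewrite size_polyDl ?size_polyXn // size_polyN size_polyX ltnS prime_gt1.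
have : (size s < size ('X^p - 'X : {poly K})%R)%N.
  apply: max_poly_roots us; first by rewrite -size_poly_eq0 sQ.
  have fix_root y : y ^+ p = y -> root ('X^p - 'X) y.
    by move=> yp; rewrite rootE !hornerE hornerXn yp subrr.
  rewrite /= fix_root //=; apply/allP => _ /mapP[n _ ->]; apply: fix_root.
  exact: (pFrobenius_aut_nat charK).
by rewrite sQ /= size_map size_iota ltnn.
Qed.

Definition uea_lift_morph (K : fieldType) (L : lieAlgType K) (A : algType K)
    (f : L -> A) (fH : lie_hom_to_alg f) : {lrmorphism uea L -> A} :=
  HB.pack (uea_lift f)
    (GRing.isLinear.Build K (uea L) A *:%R _ (uea_lift_linear fH))
    (GRing.isMonoidMorphism.Build (uea L) A _ (uea_lift_monoid fH)).

Definition uea_map_morph (K : fieldType) (L L' : lieAlgType K) (h : L -> L')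
  (hH : lie_hom h) : {lrmorphism uea L -> uea L'} := uea_lift_morph (uea_map_hom hH).

Lemma rmorph_pdefect (K : fieldType) p (L : lieAlgType K) (ppow : L -> L)
    (A A' : algType K) (F : {lrmorphism A -> A'}) (f : L -> A) (x : L) :
  F (pdefect p ppow f x) = F (f x) ^+ p - F (f (ppow x)).
Proof. by rewrite /pdefect rmorphB rmorphXn. Qed.

(** * The p-centre of U(gl_N) and its invariant determinant *)

Section PCentre.
Variables (K : fieldType) (p : nat) (charK : p \in [pchar K]) (N' : nat).
Local Notation N := N'.+1.
Local Notation Ug := (uea 'M[K]_N).

Lemma mx_lie_hom : lie_hom_to_alg (id : 'M[K]_N -> 'M[K]_N).
Proof. by []. Qed.

Definition pcentral (x : 'M[K]_N) : Ug :=
  pdefect p (fun y : 'M[K]_N => y ^+ p) (@uea_in K 'M[K]_N) x.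

Lemma pcentral_in_centre x : pcentral x \in centre_mem Ug.
Proof.
apply/asboolP; elim/uea_ind => [|a u v Hu Hv|u v Hu Hv|y].
- by rewrite mulr1 mul1r.
- by rewrite mulrDr [RHS]mulrDl -scalerAl -scalerAr Hu Hv.
- by rewrite mulrA Hu -mulrA Hv mulrA.
exact: (pdefect_comm charK mx_lie_hom (@inj_id _) (fun=> erefl) (uea_in_hom _)).
Qed.

Lemma pcentral_sum (I : finType) (c : I -> K) (x : I -> 'M[K]_N) :
  pcentral (\sum_i c i *: x i) = \sum_i c i ^+ p *: pcentral (x i).
Proof.
have xiD := pdefectD charK mx_lie_hom (@inj_id _) (fun=> erefl) (uea_in_hom _).
have xi0 := pdefect0 charK mx_lie_hom (@inj_id _) (fun=> erefl) (uea_in_hom _).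
rewrite /pcentral (big_morph _ xiD xi0); apply: eq_bigr => i _.
exact: (pdefectZ mx_lie_hom (@inj_id _) (fun=> erefl) (uea_in_hom _)).
Qed.

Lemma Ad_exp (g x : 'M[K]_N) n : g \in unitmx -> Ad g x ^+ n = Ad g (x ^+ n).
Proof.
move=> Hg; elim: n => [|n IH]; first by rewrite !expr0 /Ad mulmx1 mulmxV.
by rewrite !exprS IH /Ad -[RHS]mulmxA -!mulmxE !mulmxA mulmxKV.
Qed.

Lemma uea_Ad_pcentral g x : g \in unitmx ->
  uea_map (Ad g) (pcentral x) = pcentral (Ad g x).
Proof.
move=> Hg; rewrite -[LHS]/(uea_map_morph (Ad_hom Hg) (pcentral x)).
have FE y : uea_map_morph (Ad_hom Hg) (uea_in y) = uea_in (Ad g y).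
  exact: uea_liftE (uea_map_hom (Ad_hom Hg)) y.
by rewrite rmorph_pdefect !FE /pcentral /pdefect Ad_exp.
Qed.

Lemma Ad_delta (g : 'M[K]_N) i j :
  Ad g (delta_mx i j) = \sum_k \sum_l (g k i * invmx g j l) *: delta_mx k l.
Proof.
rewrite [LHS]matrix_sum_delta; apply: eq_bigr => k _; apply: eq_bigr => l _.
congr (_ *: _); rewrite /Ad mxE (bigD1 j) //= big1 ?addr0 => [|m mj].
  rewrite mxE (bigD1 i) //= big1 ?addr0 => [|m mi]; first by rewrite mxE !eqxx mulr1.
  by rewrite mxE (negPf mi) mulr0.
by rewrite mxE big1 ?mul0r // => a _; rewrite mxE (negPf mj) andbF mulr0.
Qed.

Definition pcentral_mx : 'M[centre Ug]_N :=
  \matrix_(i, j) Centre (pcentral_in_centre (delta_mx i j)).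

Lemma uea_Ad_det (g : 'M[K]_N) (t : K) : g \in unitmx ->
  uea_map (Ad g) (val (\det (t%:A%:M - pcentral_mx))) =
  val (\det (t%:A%:M - pcentral_mx)).
Proof.
move=> Hg.
(* Since [pcentral] is p-semilinear, [g] acts on [pcentral_mx] through the Frobenius twists [P] and
   [Q] of [g] and its inverse. The matrix of images is the conjugate [P^T *m pcentral_mx *m Q^T]. *)
pose ff : {rmorphism K -> centre Ug} := in_alg (centre Ug) \o pFrobenius_aut charK.
pose P := map_mx ff g; pose Q := map_mx ff (invmx g).
have QP : P *m Q = 1%:M by rewrite -map_mxM mulmxV // map_mx1.
have E : \det (P^T *m (t%:A%:M - pcentral_mx) *m Q^T) = \det (t%:A%:M - pcentral_mx).
  by rewrite !det_mulmx !det_tr mulrAC -det_mulmx QP det1 mul1r.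
rewrite -[LHS]/(uea_map_morph (Ad_hom Hg) _) -[in RHS]E.
have FE x : uea_map_morph (Ad_hom Hg) (pcentral x) = pcentral (Ad g x).
  exact: uea_Ad_pcentral.
move: (uea_map_morph (Ad_hom Hg)) FE => F FE.
rewrite -!det_map_mx -map_mx_comp; congr (\det _); apply/matrixP => i j.
rewrite mulmxBr mulmxBl mul_mx_scalar -scalemxAl -trmx_mul (mulmx1C QP) trmx1.
rewrite scalemx1 !mxE.
rewrite !(rmorphB, rmorphMn, linearZ, rmorph1) /=.
rewrite !(rmorphB, rmorphMn, linearZ, rmorph1) /=.
congr (_ - _); transitivity (F (pcentral (delta_mx i j))); first by rewrite [RHS]rmorphB.
rewrite FE Ad_delta pair_big /= pcentral_sum.
rewrite -(pair_big xpredT xpredT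
  (fun k l => (g k i * invmx g j l) ^+ p *: pcentral (delta_mx k l))).
rewrite exchange_big /=.
apply: etrans _ (esym (raddf_sum (\val : {additive centre Ug -> Ug}) _ _ _)).
apply: eq_bigr => l _; rewrite mxE mulr_suml raddf_sum; apply: eq_bigr => k _.
rewrite !mxE mulr_algl mulr_algr scalerA mulrC -exprMn.
by rewrite [RHS]linearZ.
Qed.
End PCentre.

(** * The group M and the stability of U(g) m_chi *)

Section UnipotentGroup.
Import mpoly.
Variables (K : closedFieldType) (N : nat) (pi : pyramid N).
Local Notation col := (col_of pi).
Local Notation Ug := (uea 'M[K]_N).
Implicit Types x y g : 'M[K]_N.

(* x lies in the sum of the graded pieces of degree at most -d, for the grading
   in which e_{i,j} has degree col(j) - col(i). *)
Definition low (d : nat) x : Prop := forall i j, (col i < col j + d)%N -> x i j = 0.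

Lemma lowD d x y : low d x -> low d y -> low d (x + y).
Proof. by move=> Hx Hy i j ij; rewrite mxE Hx // Hy // addr0. Qed.

Lemma low_mul d e x y : low d x -> low e y -> low (d + e) (x *m y).
Proof.
move=> Hx Hy i j ij; rewrite mxE big1 // => k _.
have [ik|ki] := ltnP (col i) (col k + d); first by rewrite Hx // mul0r.
rewrite [y k j]Hy ?mulr0 // -(ltn_add2r d); apply: leq_ltn_trans ki _.
by rewrite -addnA [(e + d)%N]addnC.
Qed.

Lemma low_le d e x : (e <= d)%N -> low d x -> low e x.
Proof. by move=> ed Hx i j ij; apply: Hx; apply: leq_trans ij _; rewrite leq_add2l. Qed.

Lemma low1P x : low 1 x <-> x \in m_space pi K.
Proof.
split=> [Hx|/mem_unit_span Hx i j]; first apply/mem_unit_span => i j.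
  by rewrite -leqNgt => ij; apply: Hx; rewrite addn1.
by rewrite addn1 ltnS leqNgt => /Hx.
Qed.

(** The (i, j) entry of [y *m x] involves only [y i k] with col(k) > col(j), so the entries of [y]
    vanish by descending induction on col(j). *)
Lemma low1_quasi_inverse x y : low 1 x -> y + x + y *m x = 0 -> low 1 y.
Proof.
move=> Hx yx i j; rewrite addn1 ltnS.
have [m] := ubnP (\max_k col k - col j)%N; elim: m i j => // m IH i j Hm ij.
have := congr1 (fun z : 'M_N => z i j) yx; rewrite !mxE Hx ?addn1 // addr0.
rewrite big1 ?addr0 // => k _.
have [jk|kj] := ltnP (col j) (col k); last by rewrite [x k j]Hx ?mulr0 ?addn1.
rewrite IH ?mul0r //; last exact: leq_trans ij (ltnW jk).
rewrite -ltnS; apply: leq_trans Hm; rewrite ltnS; apply: (ltn_sub2l _ jk).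
by apply: leq_trans jk _; apply: leq_bigmax.
Qed.

(** An explicit closed subgroup containing the root subgroups; by minimality it contains M, which
    turns membership in M into conditions on matrix entries. *)
Definition unipotent g : Prop := g \in unitmx /\ low 1 (g - 1%:M).

Lemma unipotent_inv g : unipotent g -> unipotent (invmx g).
Proof.
move=> [gu Hg]; split; first by rewrite unitmx_inv.
apply: low1_quasi_inverse Hg _.
rewrite mulmxBr mulmxBl mulVmx // mul1mx mulmx1.
by rewrite -[1%:M - g]opprB -opprD [X in _ - X]addrC subrr.
Qed.

Lemma unipotent_zariski_closed : zariski_closed unipotent.
Proof.
exists (fun f => exists i j, (col i < col j + 1)%N /\
   f = 'X_(mxvec_index i j) - ((1%:M : 'M[K]_N) i j)%:MP) => g gu.
split=> [[_ Hg] _ [i [j [ij ->]]]|Hg].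
  by rewrite mevalB mevalXU mevalC mxvecE; have := Hg _ _ ij; rewrite !mxE.
split=> // i j ij; have := Hg _ (ex_intro _ i (ex_intro _ j (conj ij erefl))).
by rewrite mevalB mevalXU mevalC mxvecE !mxE.
Qed.

Lemma unipotent_closed_subgroup : closed_subgroup unipotent.
Proof.
split=> [g [] //||g h [gu Hg] [hu Hh]||]; last 2 first.
- exact: unipotent_inv.
- exact: unipotent_zariski_closed.
- by split; rewrite ?unitmx1 // subrr => i j _; rewrite mxE.
split; first by rewrite unitmx_mul gu.
have -> : g *m h - 1%:M = (g - 1%:M) *m (h - 1%:M) + (g - 1%:M) + (h - 1%:M).
  by rewrite mulmxBr mulmx1 subrK mulmxBl mul1mx addrA subrK.
apply: lowD => //; apply: lowD => //; apply: (@low_le 2) => //.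
exact: (@low_mul 1 1).
Qed.

Lemma Mgroup_unipotent g : Mgroup pi g -> unipotent g.
Proof.
move=> Hg; apply: (Hg unipotent unipotent_closed_subgroup) => i j s ij.
split; first exact: Mgroup_unit (Mgroup_root s ij).
rewrite addrC addKr => a b ab; rewrite !mxE; case: eqP => [ai|]; rewrite ?mulr0 //.
by case: eqP => [bj|]; rewrite ?mulr0 //; move: ab; rewrite ai bj addn1 ltnS leqNgt ij.
Qed.

(** [nilp_e] has degree 1, so the trace form pairs it only with degree -1. *)
Lemma chi_low x : low 2 x -> chi pi x = 0.
Proof.
move=> Hx; rewrite /chi /nilp_e mulmx_suml raddf_sum big1 // => i _ /=.
rewrite mulmx_suml raddf_sum big1 // => j /andP[_ /eqP ij] /=.
rewrite /mxtrace big1 // => a _; rewrite mxE big1 // => b _; rewrite mxE.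
have [->|_] := eqVneq a i; last by rewrite mul0r.
have [->|_] := eqVneq b j; last by rewrite andbF mul0r.
by rewrite mul1r Hx // -ij addn2.
Qed.

Lemma Ad_unipotent g x : unipotent g -> low 1 x -> low 2 (Ad g x - x).
Proof.
move=> Hg Hx; have [gu Hg1] := Hg; have [_ Hg2] := unipotent_inv Hg.
have -> : Ad g x - x = (g - 1%:M) *m x + g *m (x *m (invmx g - 1%:M)).
  by rewrite /Ad mulmxBl !mulmxBr mulmx1 mul1mx [RHS]addrC addrA subrK mulmxA.
have g0 : low 0 g.
  rewrite -[g](subrK 1%:M); apply: lowD => [|i j]; first exact: low_le Hg1.
  by rewrite addn0 mxE; have [->|//] := eqVneq i j; rewrite ltnn.
by apply: lowD; [exact: (@low_mul 1 1)|apply: (low_mul g0); exact: (@low_mul 1 1)].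
Qed.

(** On m, Ad(g) changes [x] only in degrees at most -2, where [chi] vanishes. It therefore maps each
    generator x - chi(x) to another one. *)
Lemma Ug_mchi_Ad g w : unipotent g -> Ug_mchi pi w -> Ug_mchi pi (uea_map (Ad g) w).
Proof.
move=> Hg [s Hs ->]; have [gu _] := Hg.
rewrite -[uea_map _ _]/(uea_map_morph (Ad_hom gu) _).
have FE x : uea_map_morph (Ad_hom gu) (uea_in x) = uea_in (Ad g x).
  exact: uea_liftE (uea_map_hom (Ad_hom gu)) x.
move: (uea_map_morph (Ad_hom gu)) FE => F FE.
rewrite raddf_sum big_seq; elim/big_ind: _ => [||[a x] /Hs /= Hx].
- exact: Ug_mchi0.
- exact: Ug_mchiD.
rewrite rmorphM rmorphB /= FE linearZ /= rmorph1; apply: Ug_mchiM.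
have {}Hx : low 1 x by apply/low1P.
have Hgx := Ad_unipotent Hg Hx.
have -> : chi pi x = chi pi (Ad g x).
  apply/esym/eqP; rewrite -subr_eq0 -mulN1r addrC.
  rewrite -[X in X == _](chi_linear pi (-1) x (Ad g x)) scaleN1r addrC.
  by rewrite chi_low.
apply: Ug_mchi_gen; apply/low1P; rewrite -[Ad g x](subrK x); apply: lowD => //.
exact: low_le Hgx.
Qed.

End UnipotentGroup.

(** * The elements of the W-algebra obtained from the determinant *)

Section CharacteristicDeterminant.
Variables (K : closedFieldType) (p : nat) (charK : p \in [pchar K]) (N' : nat).
Local Notation N := N'.+1.
Variable pi : pyramid N.
Local Notation col := (col_of pi).
Local Notation Ug := (uea 'M[K]_N).
Local Notation Up := (uea (par pi K)).

Lemma par_val_to_alg : lie_hom_to_alg (par_val (pi := pi) (K := K) : _ -> 'M[K]_N).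
Proof. exact: par_val_hom. Qed.

Let p_gt0 : (0 < p)%N := prime_gt0 (pcharf_prime charK).

Let par_val_ppow (x : par pi K) :
  (par_val (par_ppow p x) : 'M[K]_N) = par_val x ^+ p.
Proof. exact: par_ppowE. Qed.

Let par_val_inj : injective (par_val (pi := pi) (K := K)).
Proof. exact: val_inj. Qed.

(** For col(i) > col(j) the matrix unit lies outside p, and this is merely some element of p. *)
Definition par_unit (i j : 'I_N) : par pi K := vsproj (par_space pi K) (delta_mx i j).

Lemma par_unitE i j : (col i <= col j)%N -> par_val (par_unit i j) = delta_mx i j.
Proof.
move=> ij; apply: vsprojK; apply/mem_unit_span => a b; rewrite mxE.
by case: eqP => // ->; case: eqP => // ->; rewrite ij.
Qed.

(** The matrix [pcentral_mx] with each entry replaced by its representative in U(p) modulo U(g)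
    m_chi. *)
Definition eta_mx : 'M[Up]_N := \matrix_(i, j)
  if (col i <= col j)%N
  then pdefect p (par_ppow p) (@uea_in K (par pi K)) (par_unit i j)
  else (chi pi (delta_mx i j) ^+ p)%:A.

Definition eta_det (t : K) : Up := \det (t%:A%:M - eta_mx).

Lemma delta_exp_pchar i j : i != j -> (delta_mx i j : 'M[K]_N) ^+ p = 0.
Proof.
move=> ij; case: p (prime_gt1 (pcharf_prime charK)) => [|[|m]] // _.
by rewrite !exprS mulrA -mulmxE mul_delta_mx_0 ?mul0mx ?mulmx0 ?mul0r // eq_sym.
Qed.

(** Here e_{i,j}^[p] = 0, and with c = chi(e_{i,j}) Frobenius gives e_{i,j}^p - c^p = (e_{i,j} -
    c)^p, a left multiple of e_{i,j} - c. *)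
Lemma pcentral_delta_congr i j : (col j < col i)%N ->
  Ug_mchi (K := K) pi (pcentral p (delta_mx i j) - (chi pi (delta_mx i j) ^+ p)%:A).
Proof.
move=> ij; have nij : i != j by apply: contraTneq ij => ->; rewrite ltnn.
have charU : p \in [pchar Ug] by apply: (rmorph_pchar (in_alg Ug)).
rewrite /pcentral /pdefect delta_exp_pchar // raddf0 subr0.
have -> : (chi pi (delta_mx i j) ^+ p)%:A = (chi pi (delta_mx i j))%:A ^+ p :> Ug.
  by rewrite exprZn expr1n.
rewrite -!(pFrobenius_autE charU) -pFrobenius_autB_comm; last first.
  by rewrite /GRing.comm mulr_algl mulr_algr.
rewrite pFrobenius_autE -(prednK p_gt0) exprSr; apply: Ug_mchiM; apply: Ug_mchi_gen.
apply/mem_unit_span => a b; rewrite mxE.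
by case: eqP => // ->; case: eqP => // ->; rewrite ij.
Qed.

Lemma Up_to_Ug_eta_det t :
  Ug_mchi (K := K) pi
    (Up_to_Ug (eta_det t) - val (\det (t%:A%:M - pcentral_mx charK N'))).
Proof.
rewrite -[Up_to_Ug _]/(uea_map_morph (@par_val_hom K N pi) _).
have FE x : uea_map_morph (@par_val_hom K N pi) (uea_in x) = uea_in (par_val x).
  exact: uea_liftE (uea_map_hom (@par_val_hom K N pi)) x.
move: (uea_map_morph (@par_val_hom K N pi)) FE => F FE.
rewrite /eta_det -!det_map_mx.
apply: det_congr_left_ideal => [||a x|i j x|i j].
- exact: Ug_mchi0.
- exact: Ug_mchiD.
- exact: Ug_mchiM.
- by rewrite mxE; apply: centre_valC.
rewrite !mxE !rmorphB opprD addrACA opprK.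
rewrite !rmorphMn /= !rmorph_alg subrr add0r.
have [ij|ij] := leqP (col i) (col j).
  rewrite rmorph_pdefect !FE par_val_ppow par_unitE // addNr.
  exact: Ug_mchi0.
by rewrite rmorph_alg addrC; apply: pcentral_delta_congr.
Qed.

(** Modulo the stable left ideal U(g) m_chi, the element [u] agrees with the invariant [z], so g.u
    is congruent to g.z = z and thus to [u]. *)
Lemma eta_det_walg t : eta_det t \in walg_mem (pi := pi) (K := K).
Proof.
apply/asboolP => g Hg; rewrite /tw_graph /pr_graph.
set u := Up_to_Ug _; set z := val (\det (t%:A%:M - pcentral_mx charK N')).
have gu := Mgroup_unit Hg.
have Hz : uea_map (Ad g) z = z by exact: uea_Ad_det.
have Huz : Ug_mchi pi (u - z) by exact: Up_to_Ug_eta_det.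
have := Ug_mchi_Ad (Mgroup_unipotent Hg) Huz.
rewrite -[uea_map _ _]/(uea_map_morph (Ad_hom gu) _) rmorphB /=.
rewrite [X in _ - X]Hz => H.
have := Ug_mchiD H (Ug_mchiZ (-1) Huz).
by rewrite scaleN1r opprB addrA subrK.
Qed.

Lemma eta_det_J0 t : J0 p (eta_det t - (t ^+ N)%:A).
Proof.
pose I : proper_ideal2 Up :=
  ProperIdeal2 (ideal_gen_ideal2 _) (J0_proper (pi := pi) (K := K) p_gt0).
apply/(quot_piP I); rewrite /eta_det -det_map_mx.
pose C : 'M[K]_N := \matrix_(i, j)
  if (col i <= col j)%N then 0 else chi pi (delta_mx i j) ^+ p.
(* In the quotient all entries are scalars, so the determinant can be taken over the commutative
   ring [K], where [det_trig_by] applies. *)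
have -> : map_mx (quot_pi I) (t%:A%:M - eta_mx)
    = map_mx (in_alg (quot_alg I)) (t%:M - C).
  apply/matrixP => i j; rewrite !mxE !rmorphB; congr (_ - _).
    by rewrite !rmorphMn /= rmorph_alg.
  have [ij|ij] := leqP (col i) (col j); last exact: rmorph_alg.
  rewrite rmorph0 -(rmorph0 (quot_pi I)); apply/(quot_piP I); rewrite subr0.
  by apply: ideal_gen_sub; exists (par_unit i j).
rewrite det_map_mx (@det_trig_by _ _ col) => [|i j ij cij].
  under eq_bigr do rewrite !mxE leqnn eqxx subr0 mulr1n.
  by rewrite big_const_ord iter_mulr_1 [RHS]rmorph_alg.
by rewrite !mxE (negPf ij) cij subr0.
Qed.

Variables (A : {ffun 'I_N -> K}) (HA : column_connected pi A).

Definition ktilde_morph : {lrmorphism Up -> K^o} :=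
  HB.pack (ktilde A)
    (GRing.isLinear.Build K Up K^o *:%R _ (ktilde_linear HA))
    (GRing.isMonoidMorphism.Build Up K^o _ (ktilde_monoid HA)).

Lemma ktilde_par_unit i j : (col i <= col j)%N ->
  ktilde A (uea_in (par_unit i j)) = weight pi A i *+ (i == j).
Proof.
move=> ij; rewrite (ktildeE _ HA) -/(par_val _) par_unitE // (bigD1 i) //=.
rewrite big1 ?addr0 => [|k ki]; first by rewrite mxE eqxx /= mulr_natr.
by rewrite mxE (negPf ki) mulr0.
Qed.

Lemma delta_diag_exp i n : (0 < n)%N -> (delta_mx i i : 'M[K]_N) ^+ n = delta_mx i i.
Proof.
case: n => // n _; elim: n => // n IH.
by rewrite exprS IH -mulmxE mul_delta_mx.
Qed.

Lemma ktilde_par_ppow i j : (col i <= col j)%N ->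
  ktilde A (uea_in (par_ppow p (par_unit i j))) = weight pi A i *+ (i == j).
Proof.
move=> ij; rewrite (ktildeE _ HA) -/(par_val _) par_val_ppow par_unitE //.
have [<-|nij] := eqVneq i j; last first.
  by rewrite delta_exp_pchar // big1 // => k _; rewrite mxE mulr0.
rewrite delta_diag_exp // (bigD1 i) //= big1 ?addr0 => [|k ki].
  by rewrite mxE eqxx mulr1.
by rewrite mxE (negPf ki) mulr0.
Qed.

Lemma ktilde_pdefect_unit i j : (col i <= col j)%N ->
  ktilde A (pdefect p (par_ppow p) (@uea_in K (par pi K)) (par_unit i j)) =
  (weight pi A i ^+ p - weight pi A i) *+ (i == j).
Proof.
move=> ij; rewrite -[LHS]/(ktilde_morph _) rmorph_pdefect /=.
rewrite ktilde_par_unit // ktilde_par_ppow //.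
by case: eqP => // _; rewrite mulr0n expr0n gtn_eqF // subrr.
Qed.

Lemma ktilde_eta_det t :
  ktilde A (eta_det t) = \prod_i (t - (weight pi A i ^+ p - weight pi A i)).
Proof.
rewrite -[LHS]/(ktilde_morph _) -det_map_mx (@det_trig_by _ _ col) => [|i j ij cij].
  apply: eq_bigr => i _; rewrite !mxE leqnn eqxx mulr1n rmorphB; congr (_ - _).
    exact: etrans (rmorph_alg ktilde_morph t) (mulr1 _).
  by rewrite -[LHS]/(ktilde A _) ktilde_pdefect_unit // eqxx.
rewrite !mxE (negPf ij) cij rmorphB rmorph0 sub0r /= ktilde_pdefect_unit //.
by rewrite (negPf ij) oppr0.
Qed.

Lemma par_sum_unit (x : par pi K) :
  x = \sum_(ij : 'I_N * 'I_N) (par_val x : 'M_N) ij.1 ij.2 *: par_unit ij.1 ij.2.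
Proof.
apply: par_val_inj; rewrite /par_val raddf_sum /= [LHS]matrix_sum_delta pair_big /=.
apply: eq_bigr => -[i j] _ /=.
have [ij|ij] := leqP (col i) (col j); first by rewrite -(par_unitE ij).
by have /mem_unit_span -> := subvsP x; rewrite ?scale0r // -ltnNge.
Qed.

Lemma ktilde_pdefect x : (forall i, weight pi A i ^+ p = weight pi A i) ->
  ktilde A (pdefect p (par_ppow p) (@uea_in K (par pi K)) x) = 0.
Proof.
move=> wp; have inH := uea_in_hom (par pi K).
have eD := pdefectD charK par_val_to_alg par_val_inj par_val_ppow inH.
have e0 := pdefect0 charK par_val_to_alg par_val_inj par_val_ppow inH.
rewrite (par_sum_unit x) (big_morph _ eD e0) -[LHS]/(ktilde_morph _) raddf_sum.
apply: big1 => -[i j] _ /=.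
have [ij|ij] := leqP (col i) (col j); last first.
  have /mem_unit_span -> := subvsP x; last by rewrite -ltnNge.
  by rewrite scale0r e0; apply: (rmorph0 ktilde_morph).
rewrite (pdefectZ par_val_to_alg par_val_inj par_val_ppow inH).
rewrite -[LHS]/(ktilde_morph _) linearZ /= ktilde_pdefect_unit //.
by rewrite wp subrr mul0rn scaler0.
Qed.

End CharacteristicDeterminant.

(** * Factoring characters, and the equivalence *)

Lemma quot_lrmorph (K : fieldType) (B C : algType K) (I : proper_ideal2 B)
    (F : {lrmorphism B -> C}) : (forall x, I x -> F x = 0) ->
  exists psi : {lrmorphism quot_alg I -> C}, forall x, psi (quot_pi I x) = F x.
Proof.
move=> FI; pose f (q : quot_alg I) : C := F (quot_repr q).
have fE x : f (quot_pi I x) = F x.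
  apply/eqP; rewrite -subr_eq0 -rmorphB; apply/eqP/FI/quot_piP.
  by rewrite quot_reprK.
have ind (P : quot_alg I -> Prop) : (forall x, P (quot_pi I x)) -> forall q, P q.
  by move=> H q; rewrite -(quot_reprK q).
have flin : linear f.
  by move=> a; elim/ind => x; elim/ind => y; rewrite -linearP !fE linearP.
have fmul : monoid_morphism f.
  split; first by rewrite -(rmorph1 (quot_pi I)) fE rmorph1.
  by elim/ind => x; elim/ind => y; rewrite -rmorphM !fE rmorphM.
pose psi : {lrmorphism quot_alg I -> C} := HB.pack f
  (GRing.isLinear.Build K (quot_alg I) C *:%R _ flin)
  (GRing.isMonoidMorphism.Build (quot_alg I) C _ fmul).
by exists psi.
Qed.

(** All terms of [rho] are images of natural numbers, which Frobenius fixes. *)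
Lemma rho_Fp (K : closedFieldType) p (charK : p \in [pchar K]) N (pi : pyramid N) i :
  (rho K pi i) ^+ p = rho K pi i.
Proof.
rewrite /rho -!(pFrobenius_autE charK) !rmorphB /= rmorph_sum /= !rmorph_nat.
by congr (_ - _ - _); apply: eq_bigr => c _; apply: rmorph_nat.
Qed.

Theorem theorem6p1 (K : closedFieldType) (p : nat) (charK : p \in [pchar K])
    (N : nat) (N_gt0 : (0 < N)%N) (pi : pyramid N) (A : {ffun 'I_N -> K})
    (HA : column_connected pi A) :
  factors_to_rwalg pi charK (ktilde_bar pi A) <-> Fp_tableau p A.
Proof.
case: N N_gt0 pi A HA => // N' _ pi A HA.
have Flin : linear (ktilde_bar pi A).
  by move=> a u v; rewrite /ktilde_bar linearP; apply: ktilde_linear.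
have Fmul : monoid_morphism (ktilde_bar pi A).
  have [k1 kM] := ktilde_monoid HA.
  by split=> [|u v]; rewrite /ktilde_bar ?rmorph1 ?rmorphM // kM.
pose F : {lrmorphism walg K pi -> K^o} := HB.pack (ktilde_bar pi A)
  (GRing.isLinear.Build K (walg K pi) K^o *:%R _ Flin)
  (GRing.isMonoidMorphism.Build (walg K pi) K^o _ Fmul).
have p_pr := pcharf_prime charK.
split=> [[psi psiE]|[B BE]].
  have wp i : weight pi A i ^+ p = weight pi A i.
    (* This [t] kills the i-th factor in [ktilde_eta_det], so the vanishing of the character on
       [eta_det p pi t - (t ^+ N'.+1)%:A] leaves a zero power of [t]. *)
    apply/eqP; rewrite -subr_eq0; set t := weight _ _ _ ^+ _ - _.
    have zW : eta_det p pi t - (t ^+ N'.+1)%:A \in walg_mem (pi := pi) (K := K).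
      by rewrite rpredB ?rpredZ ?rpred1 // eta_det_walg.
    have := psiE (Walg zW).
    have -> : to_rwalg charK (Walg zW) = 0.
      rewrite -(rmorph0 (quot_pi _)); apply/quot_piP; rewrite subr0.
      exact: eta_det_J0.
    rewrite rmorph0 -[RHS]/(ktilde_morph HA (_ - _)) rmorphB.
    rewrite [X in _ - X](rmorph_alg (ktilde_morph HA)).
    rewrite [X in X - _](ktilde_eta_det charK HA).
    rewrite (bigD1 i) //= subrr mul0r sub0r => /esym/eqP.
    by rewrite oppr_eq0 [_%:A]mulr1 expf_eq0.
  have Ap i : A i ^+ p = A i.
    have -> : A i = weight pi A i + rho K pi i by rewrite /weight subrK.
    by rewrite -(pFrobenius_autE charK) rmorphD /= !pFrobenius_autE wp rho_Fp.
  have H i : exists b : 'F_p, A i = (nat_of_ord b)%:R.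
    have [n np ->] := pfix_natr charK (Ap i).
    (* ['F_p] is an ordinal type whose bound equals p only through [Fp_cast], by primality. *)
    have np' : (n < (Zp_trunc (pdiv p)).+2)%N by rewrite Fp_cast.
    by exists (Ordinal np').
  by have [f fE] := choice H; exists [ffun i => f i] => i; rewrite ffunE.
have wp i : weight pi A i ^+ p = weight pi A i.
  rewrite /weight BE -!(pFrobenius_autE charK) rmorphB /= rmorph_nat.
  by rewrite pFrobenius_autE rho_Fp.
apply: (@quot_lrmorph _ _ _ _ F) => u Hu.
(* Membership in the generated ideal is tested on the kernel of the character of U(p). *)
apply: (Hu (fun v => ktilde_morph HA v = 0)) => [|_ [x ->]].
  split=> [|x y Fx Fy|a x Fx|a x Fx].
  - exact: rmorph0.
  - by rewrite rmorphB [X in X - _]Fx [X in _ - X]Fy subrr.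
  - by rewrite rmorphM [X in _ * X]Fx mulr0.
  - by rewrite rmorphM [X in X * _]Fx mul0r.
exact: ktilde_pdefect.
Qed.
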